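(* Let $n$ be a positive integer coprime with $6$. Then, for any indeterminates $a$ and $q$, we have modulo $[n](1-aq^n)(a-q^n)$ the two congruences $$\sum_{k=0}^{n-1}\frac{(aq;q^2)_k (q/a;q^2)_k (q;q^2)_{2k}}{(q^2;q^2)_{2k}(aq^6;q^6)_k (q^6/a;q^6)_k }[8k+1]q^{2k^2}\equiv q^{-(n-1)/2}[n]\left(\frac{-3}{n}\right)$$ and $$\sum_{k=0}^{(n-1)/2}\frac{(aq;q^2)_k (q/a;q^2)_k (q;q^2)_{2k}}{(q^2;q^2)_{2k}(aq^6;q^6)_k (q^6/a;q^6)_k }[8k+1]q^{2k^2}\equiv q^{-(n-1)/2}[n]\left(\frac{-3}{n}\right).$$
   Context: Notation: $(x;y)_k=\prod_{j=0}^{k-1}(1-xy^j)$ (with $(x;y)_0=1$) and $[k]=\frac{1-q^k}{1-q}$. The symbol $\left(\frac{-3}{n}\right)$ is the quadratic character modulo $3$: it equals $1,-1,0$ according to $n\equiv 1,2,0\pmod 3$. For rational functions $A,B$ in the indeterminates over $\mathbb Z$ and a polynomial $P$ in the same indeterminates with integer coefficients, $A\equiv B\pmod P$ means that $A-B=A_1/A_2$ with $A_1,A_2$ polynomials with integer coefficients, where $P$ divides $A_1$ and $P$ is coprime with $A_2$. *)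

(* Defs.v *)
From mathcomp Require Import all_boot all_order all_algebra.

Set Implicit Arguments.
Unset Strict Implicit.
Unset Printing Implicit Defensive.

Import GRing.Theory.
Local Open Scope ring_scope.

(* Divisibility and coprimality in an arbitrary integral domain.  For         *)
(* {poly {poly int}} the %| and coprimep of polydiv are not suitable: they    *)
(* are pseudo-division notions, valid only up to a nonzero scalar factor.     *)
Definition divides (R : idomainType) (x y : R) : Prop := exists z, y = z * x.

Definition coprime_elts (R : idomainType) (x y : R) : Prop :=
  forall d : R, divides d x -> divides d y -> d \is a GRing.unit.

Definition frac_cong (R : idomainType) (A B : {fraction R}) (P : R) : Prop :=
  exists A1 A2 : R,
    [/\ A2 != 0, A - B = FracField.tofrac A1 / FracField.tofrac A2,
        divides P A1 & coprime_elts P A2].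

Definition qpoch (F : fieldType) (x y : F) (k : nat) : F :=
  \prod_(j < k) (1 - x * y ^+ j).

Definition qnum (F : fieldType) (q : F) (k : nat) : F := (1 - q ^+ k) / (1 - q).

Definition char3 (n : nat) : int :=
  if (n %% 3 == 1)%N then 1 else if (n %% 3 == 2)%N then -1 else 0.

(* Z[a, q] is encoded as Z[q][a]: the outer variable is a, the inner one q. *)
Definition Zaq : idomainType := {poly {poly int}}.
Definition poly_a : Zaq := 'X.
Definition poly_q : Zaq := 'X%:P.

Definition Qaq : fieldType := {fraction Zaq}.
Definition frac_a : Qaq := FracField.tofrac poly_a.
Definition frac_q : Qaq := FracField.tofrac poly_q.

(* [n] as an element of Z[a, q]; tofrac_qnum_poly identifies it with qnum. *)
Definition qnum_poly (n : nat) : Zaq := \sum_(j < n) poly_q ^+ j.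

Definition modulus (n : nat) : Zaq :=
  qnum_poly n * (1 - poly_a * poly_q ^+ n) * (poly_a - poly_q ^+ n).

Definition summand (F : fieldType) (a q : F) (k : nat) : F :=
  qpoch (a * q) (q ^+ 2) k * qpoch (q / a) (q ^+ 2) k * qpoch q (q ^+ 2) (2 * k)
  / (qpoch (q ^+ 2) (q ^+ 2) (2 * k)
     * qpoch (a * q ^+ 6) (q ^+ 6) k * qpoch (q ^+ 6 / a) (q ^+ 6) k)
  * qnum q (8 * k + 1) * q ^+ (2 * k ^ 2).

Lemma frac_q_neq1 : 1 - frac_q != 0.
Proof.
rewrite /frac_q -tofrac1 -tofracB tofrac_eq0 subr_eq0 /poly_q -polyC1.
apply/eqP => /polyC_inj /(congr1 (fun p : {poly int} => p`_1)).
by rewrite coef1 coefX.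
Qed.

Lemma tofrac_qnum_poly (n : nat) :
  FracField.tofrac (qnum_poly n) = qnum frac_q n.
Proof.
apply: (canRL (mulfK frac_q_neq1)).
rewrite /frac_q -tofrac1 -tofracXn -!tofracB -tofracM; congr FracField.tofrac.
by rewrite -opprB mulrN mulrC -subrX1 opprB.
Qed.

(* Main.v *)
Require Import Defs.
From mathcomp Require Import all_boot all_order all_algebra.
From mathcomp Require Import all_field.
From mathcomp Require Import ring zify.
Import GRing.Theory.
Import Order.TTheory Num.Theory.
Local Open Scope ring_scope.

Set Implicit Arguments.
Unset Strict Implicit.
Unset Printing Implicit Defensive.

(** The sums are written in terms of Y = q^(2k).  The k-th summand is
    U_k(a) v_(2k) (1 - q Y^4) / (1 - q), where v_j = (q;q^2)_j / (q^2;q^2)_j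
    and U_k(a), which includes the power q^(2k^2), is the part that involves a.
    Everything rests on one Wilf-Zeilberger pair for the shift a -> a q^6
    (wz_sum): up to two boundary terms, the sum S(a) satisfies
      S(a q^6) rho(a) = S(a)
    with an explicit rational function rho.

    This relation is used twice.  At a = q^(-n) the sum stops at k = (n-1)/2,
    the boundary terms vanish, and the relation goes from n to n + 6; starting
    from n = 1 and n = 5 it gives the closed form q^(-(n-1)/2) [n] (-3/n)
    (sum_at_invpow), and the symmetry a <-> 1/a gives the same value at a = q^n.

    At a primitive d-th root of unity q, with 1 < d dividing n, the summation
    range splits into blocks of lengths (d+1)/2 and (d-1)/2 at whose ends the
    certificate vanishes.  In a block only the first K + 1 summands can be
    nonzero, with 2K < d, and after multiplication by its denominators the
    block is a polynomial T(a) of degree at most 2K.  The relation becomes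
    T(a q^6) f(a) = T(a) g(a) with explicit polynomials f and g, and the zero
    of f propagates to 2K + 1 zeros of T (dilation_eq0).  Hence T = 0, and the
    sums vanish for all but finitely many a (sum_blocks).

    It remains to pass from values to divisibility in Z[q][a].  Since
    v_j = [2j choose j]_q / ((1+q)...(1+q^j))^2, the difference of the two
    sides of the congruence is numerator / denominator, where the denominator
    is a product of powers of q, of 1 + q^i, of 1 - a q^(6i) and of a - q^(6i);
    as n is prime to 6 it has no common factor with the modulus
    (coprime_modulus_denominator).  The numerator vanishes at a = q^n and at
    a = q^(-n), so (a - q^n)(1 - a q^n) divides it; the quotient vanishes when
    q is any nontrivial n-th root of unity, so [n] divides the quotient
    (modulus_divides_numerator). *)

Lemma coprime6_odd n : coprime n 6 -> odd n.
Proof. by rewrite (@coprimeMr n 2 3) coprimen2 => /andP[]. Qed.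

(** * A Wilf-Zeilberger pair *)

(** U_(k+1) / U_k as a function of Y = q^(2k). *)
Definition step_ratio (F : fieldType) (q a Y : F) : F :=
  (1 - a * q * Y) * (a - q * Y) / ((1 - a * q ^+ 6 * Y ^+ 3) * (a - q ^+ 6 * Y ^+ 3))
  * (q * Y) ^+ 2.

(** U_k normalized to start at Y = y.  The sum itself has y = 1; a block that
    begins at the index k0 has y = q^(2 k0), which at a root of unity is 1 or q. *)
Definition step_prod (F : fieldType) (q y a : F) (k : nat) : F :=
  \prod_(l < k) step_ratio q a (y * q ^+ (2 * l)).

(** The coefficients v are left abstract, so that the same relation applies to
    the whole sequence v_(2k) and to its shifts, also at roots of unity, where
    v_j cannot be written as a quotient of q-shifted factorials. *)
Definition wz_summand (F : fieldType) (q y : F) (v : nat -> F) (a : F) (k : nat) : F :=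
  step_prod q y a k * v k * (1 - q * (y * q ^+ (2 * k)) ^+ 4).

(** The quotient U_k(a q^6) / U_k(a), up to a factor that does not depend on k;
    the factor is chosen so that Gosper summation succeeds in wz_term. *)
Definition rho (F : fieldType) (q a Y : F) : F :=
  q ^+ 3 * (1 - a * q * Y) * (1 - a * q ^+ 3 * Y) * (1 - a * q ^+ 5 * Y) * (a - Y ^+ 3)
  / ((a * q ^+ 5 - Y) * (a * q ^+ 3 - Y) * (a * q - Y) * (1 - a * q ^+ 6 * Y ^+ 3)).

(** The denominator of rho and the ratio of consecutive summands force all the
    factors that involve Y, and the polynomial left undetermined by them is the
    constant q (a^2 q^6 - 1).  The factor (1 - Y^2)(q^2 - Y^2) is what makes the
    boundary terms vanish: it is zero at Y = 1 and at Y = q. *)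
Definition certificate (F : fieldType) (q y : F) (v : nat -> F) (a : F) (k : nat) : F :=
  let Y := y * q ^+ (2 * k) in
  step_prod q y a k * v k * ((1 - Y ^+ 2) * (q ^+ 2 - Y ^+ 2) * q
    * (a ^+ 2 * q ^+ 6 - 1) * (a - Y ^+ 3)
  / ((a * q ^+ 5 - Y) * (a * q ^+ 3 - Y) * (a * q - Y))).

(** The recurrence of v_(2k), kept free of division because both sides can
    vanish when q is a root of unity. *)
Definition two_step_rec (F : fieldType) (q y : F) (v : nat -> F) : Prop := forall k,
  let Y := y * q ^+ (2 * k) in
  v k.+1 * ((1 - q ^+ 2 * Y ^+ 2) * (1 - q ^+ 4 * Y ^+ 2)) =
  v k * ((1 - q * Y ^+ 2) * (1 - q ^+ 3 * Y ^+ 2)).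

(** The summands have no pole at a. *)
Definition regular (F : fieldType) (q y a : F) : Prop := forall k,
  let Y := y * q ^+ (2 * k) in
  1 - a * q ^+ 6 * Y ^+ 3 != 0 /\ a - q ^+ 6 * Y ^+ 3 != 0.

(** Neither the summands nor rho and the certificate have a pole at a. *)
Definition generic (F : fieldType) (q y a : F) : Prop :=
  regular q y a /\ forall k, let Y := y * q ^+ (2 * k) in
  [/\ a * q - Y != 0, a * q ^+ 3 - Y != 0 & a * q ^+ 5 - Y != 0].

Section WZ.
Variables (F : fieldType) (q : F).
Hypothesis q0 : q != 0.

Lemma step_prodS y a k : step_prod q y a k.+1 = step_prod q y a k * step_ratio q a (y * q ^+ (2 * k)).
Proof. by rewrite /step_prod big_ord_recr. Qed.

Lemma step_prod0 y a : step_prod q y a 0 = 1.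
Proof. by rewrite /step_prod big_ord0. Qed.

Lemma stepY (y : F) k : y * q ^+ (2 * k.+1) = q ^+ 2 * (y * q ^+ (2 * k)).
Proof. by rewrite mulnS exprD mulrCA. Qed.

(** Divided by the summand, both sides are rational functions of a, q and Y,
    and clearing denominators leaves a polynomial identity in these variables. *)
Lemma wz_term y v a k : two_step_rec q y v -> generic q y a ->
  wz_summand q y v a k * (rho q a (y * q ^+ (2 * k)) - 1) =
  certificate q y v a k.+1 - certificate q y v a k.
Proof.
move=> vr [reg gen]; have := vr k; have [n1 n2] := reg k; have [n3 n4 n5] := gen k.
have [n6 n7 n8] := gen k.+1.
move: n6 n7 n8; rewrite /certificate /wz_summand step_prodS stepY /=.
set Y := y * _ in n1 n2 n3 n4 n5 *; set w := step_prod _ _ _ _.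
move=> n6 n7 n8 vk.
(* The factor (1 - Y^2)(q^2 - Y^2) of the certificate, taken at q^2 Y, is
   q^2 d, the coefficient of v (k+1) in the recurrence. *)
pose d := (1 - q ^+ 2 * Y ^+ 2) * (1 - q ^+ 4 * Y ^+ 2).
have -> : w * step_ratio q a Y * v k.+1 *
  ((1 - (q ^+ 2 * Y) ^+ 2) * (q ^+ 2 - (q ^+ 2 * Y) ^+ 2) * q * (a ^+ 2 * q ^+ 6 - 1) *
   (a - (q ^+ 2 * Y) ^+ 3) /
   ((a * q ^+ 5 - q ^+ 2 * Y) * (a * q ^+ 3 - q ^+ 2 * Y) * (a * q - q ^+ 2 * Y))) =
  w * step_ratio q a Y * (v k.+1 * d) *
  (q ^+ 3 * (a ^+ 2 * q ^+ 6 - 1) *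
   (a - (q ^+ 2 * Y) ^+ 3) /
   ((a * q ^+ 5 - q ^+ 2 * Y) * (a * q ^+ 3 - q ^+ 2 * Y) * (a * q - q ^+ 2 * Y))).
  rewrite /d; ring.
rewrite /d vk /step_ratio /rho.
have n6' : a - q * Y != 0.
  have E : a * q - q ^+ 2 * Y = q * (a - q * Y) by ring.
  by move: n6; rewrite E mulf_eq0 (negPf q0).
field.
by rewrite n1 n2 n3 n4 n5 n6 n7 n8.
Qed.

Lemma wz_shift y a k : generic q y a -> regular q y (a * q ^+ 6) ->
  step_prod q y (a * q ^+ 6) k * rho q a y = step_prod q y a k * rho q a (y * q ^+ (2 * k)).
Proof.
move=> [reg gen] reg'; elim: k => [|k IH]; first by rewrite muln0 expr0 mulr1 !step_prod0.
rewrite !step_prodS stepY mulrAC IH -[LHS]mulrA -[RHS]mulrA; congr (_ * _).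
have [n1 n2] := reg k; have [n3 n4 n5] := gen k.
have [m1 m2] := reg k.+1; have [m3 m4 m5] := gen k.+1; have [l1 l2] := reg' k.
move: m1 m2 m3 m4 m5; rewrite stepY.
set Y := y * _ in n1 n2 n3 n4 n5 l1 l2 *.
move=> m1 m2 m3 m4 m5.
rewrite /step_ratio /rho.
field.
rewrite exprMn -exprM in m1.
by rewrite n1 n2 n3 n4 n5 l2 m1 m3 m4 m5.
Qed.

(** The relation between the sums at a q^6 and at a: summing wz_term
    telescopes, and wz_shift turns rho q a (q^(2k)) U_k(a) into U_k(a q^6). *)
Lemma wz_sum y v a N : two_step_rec q y v -> generic q y a -> regular q y (a * q ^+ 6) ->
  (\sum_(k < N) wz_summand q y v (a * q ^+ 6) k) * rho q a y =
  \sum_(k < N) wz_summand q y v a k + certificate q y v a N - certificate q y v a 0.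
Proof.
move=> vr gen reg'; elim: N => [|N IH].
  by rewrite !big_ord0 mul0r add0r subrr.
rewrite !big_ord_recr /= mulrDl IH.
have E : wz_summand q y v (a * q ^+ 6) N * rho q a y =
         wz_summand q y v a N * rho q a (y * q ^+ (2 * N)).
  have E := wz_shift N gen reg'.
  rewrite /wz_summand mulrAC (mulrAC (step_prod _ _ _ _)) E; ring.
rewrite E.
have -> : wz_summand q y v a N * rho q a (y * q ^+ (2 * N)) =
  wz_summand q y v a N * (rho q a (y * q ^+ (2 * N)) - 1) + wz_summand q y v a N by ring.
rewrite wz_term //; ring.
Qed.
End WZ.

(** * Evaluation of the sum at a = q^(-n) *)

Section PowerPoints.
Variables (F : fieldType) (q : F) (v : nat -> F).
Hypotheses (q0 : q != 0) (q_inf : forall i, (0 < i)%N -> q ^+ i != 1).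
Hypotheses (v0 : v 0 = 1) (vr : two_step_rec q 1 v).

Lemma pow_neq i j : i != j -> q ^+ i != q ^+ j.
Proof.
wlog lt_ij : i j / (i < j)%N.
  move=> H nij; case: (ltngtP i j) => [lt|lt|e]; first exact: H.
    by rewrite eq_sym; apply: H => //; rewrite eq_sym.
  by rewrite e eqxx in nij.
move=> _; rewrite -(subnKC (ltnW lt_ij)) exprD -{1}[q ^+ i]mulr1.
rewrite (inj_eq (mulfI (expf_neq0 i q0))) eq_sym q_inf // subn_gt0.
exact: lt_ij.
Qed.

Lemma invpow_sub i j k : (j != i + k)%N -> q ^- i * q ^+ j - q ^+ k != 0.
Proof.
move=> H; rewrite subr_eq0; apply/negP => /eqP /(congr1 (fun x => q ^+ i * x)).
rewrite mulrA mulfV ?expf_neq0 // mul1r -exprD => /eqP.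
by apply/negP/pow_neq.
Qed.

Lemma regular_invpow n : coprime n 6 -> regular q 1 (q ^- n).
Proof.
move=> co k /=; rewrite mul1r -exprM -[q ^- n * _ * _]mulrA -exprD.
have odd_n := coprime6_odd co.
split.
  by rewrite -oppr_eq0 opprB (invpow_sub (k := 0)) //; lia.
by rewrite -[q ^- n]mulr1 (invpow_sub (j := 0)) //; lia.
Qed.

(** The bound on n is sharp: for n = 5 the factor a q^5 - Y vanishes at Y = 1. *)
Lemma generic_invpow n : (5 < n)%N -> coprime n 6 -> generic q 1 (q ^- n).
Proof.
move=> n5 co; split=> [|k /=]; first exact: regular_invpow.
have odd_n := coprime6_odd co.
rewrite mul1r -{2}[q]expr1; split; apply: invpow_sub; lia.
Qed.

(** The factor 1 - a q^(2l+1) is zero for l = (n-1)/2. *)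
Lemma step_prod_vanish n k : odd n -> (n < 2 * k)%N -> step_prod q 1 (q ^- n) k = 0.
Proof.
move=> odd_n nk; have lt : (n./2 < k)%N by lia.
rewrite /step_prod (bigD1 (Ordinal lt)) //= /step_ratio mul1r.
rewrite -[q ^- n * q * _]mulrA -exprS (_ : (2 * n./2).+1 = n); last lia.
by rewrite mulVf ?subrr ?mul0r ?expf_neq0.
Qed.

Lemma sum_trunc n N : odd n -> (n < 2 * N)%N ->
  \sum_(k < N) wz_summand q 1 v (q ^- n) k =
  \sum_(k < (n./2).+1) wz_summand q 1 v (q ^- n) k.
Proof.
move=> odd_n nN; have le : ((n./2).+1 <= N)%N by lia.
rewrite -!(big_mkord xpredT (wz_summand q 1 v (q ^- n))) (big_cat_nat (leq0n _) le) /=.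
rewrite [X in _ + X]big_nat_cond [X in _ + X]big1 ?addr0 // => k /andP[/andP[lk _] _].
rewrite /wz_summand step_prod_vanish ?mul0r //; lia.
Qed.

(** At Y = 1 the function rho reduces to q^3 (1 - a) / (1 - a q^6). *)
Lemma sum_step n N : coprime n 6 -> (n + 6 < 2 * N)%N ->
  (\sum_(k < N) wz_summand q 1 v (q ^- (n + 6)) k) * (q ^+ 3 * (1 - q ^+ n)) =
  (\sum_(k < N) wz_summand q 1 v (q ^- n) k) * (1 - q ^+ (n + 6)).
Proof.
move=> co nN.
have odd_n := coprime6_odd co.
have co' : coprime (n + 6) 6 by rewrite /coprime gcdnC gcdnDr gcdnC.
have gen : generic q 1 (q ^- (n + 6)) by apply: generic_invpow => //; lia.
have e6 : q ^- (n + 6) * q ^+ 6 = q ^- n.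
  by rewrite exprD invfM -mulrA mulVf ?mulr1 ?expf_neq0.
have := @wz_sum F q q0 1 v _ N vr gen; rewrite e6 => /(_ (regular_invpow co)).
have -> : certificate q 1 v (q ^- (n + 6)) 0 = 0.
  by rewrite /certificate !(muln0, expr0, mul1r, expr1n) subrr !mul0r mulr0.
have -> : certificate q 1 v (q ^- (n + 6)) N = 0.
  by rewrite /certificate step_prod_vanish ?mul0r //; lia.
rewrite subr0 addr0 => eqS.
rewrite -eqS -mulrA; congr (_ * _).
have n0 : q ^+ n != 0 by rewrite expf_neq0.
have om i : (0 < i)%N -> 1 - q ^+ i != 0.
  by move=> i0; rewrite subr_eq0 eq_sym q_inf.
have [u1 u3 u5] : [/\ 1 - q ^+ n * q != 0, 1 - q ^+ n * q ^+ 3 != 0 & 1 - q ^+ n * q ^+ 5 != 0].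
  by rewrite -{2}[q]expr1 -!exprD !om //; lia.
have u7 : q ^+ n - 1 != 0 by rewrite -opprB oppr_eq0 om //; lia.
rewrite /rho exprD; move: (q ^+ n) n0 u1 u3 u5 u7 => u n0 u1 u3 u5 u7.
field.
by rewrite !mulN1r q0 n0 u1 u3 u5 u7.
Qed.

(** (1 - q) times the right-hand side of the congruence. *)
Definition target (n : nat) : F := q ^- n./2 * (1 - q ^+ n) * (char3 n)%:~R.

Lemma target_step n : coprime n 6 ->
  target (n + 6) * (q ^+ 3 * (1 - q ^+ n)) = target n * (1 - q ^+ (n + 6)).
Proof.
move=> co; rewrite /target.
have -> : char3 (n + 6) = char3 n by rewrite /char3 -(modnDmr n 6) addn0.
have -> : ((n + 6)./2 = n./2 + 3)%N by rewrite halfD /= andbF.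
rewrite exprD invfM; move: (_%:~R) (1 - _) (1 - _) => x y z.
have : q ^+ n./2 != 0 by rewrite expf_neq0.
by move: (q ^+ n./2) => u u0; field; rewrite u0 q0.
Qed.

Lemma sum_one N : (1 < 2 * N)%N -> \sum_(k < N) wz_summand q 1 v (q ^- 1) k = target 1.
Proof.
move=> N1; rewrite sum_trunc // big_ord1 /target /wz_summand step_prod0 v0.
by rewrite /char3 /= muln0 !mulr1 !expr0 invr1 !mul1r expr1n mulr1.
Qed.

(** A separate base case, because the step from n = -1 to n = 5 meets a zero
    of the denominator of rho at a = q^(-5).  Three summands remain, and the value is a rational
    identity in q. *)
Lemma sum_five N : (5 < 2 * N)%N -> \sum_(k < N) wz_summand q 1 v (q ^- 5) k = target 5.
Proof.
move=> N5; rewrite sum_trunc // !big_ord_recl big_ord0 /bump /= /target /char3 /=.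
have om i : (0 < i)%N -> 1 - q ^+ i != 0.
  by move=> i0; rewrite subr_eq0 eq_sym q_inf.
have vE k : v k.+1 = v k * ((1 - q ^+ (1 + 4 * k)) * (1 - q ^+ (3 + 4 * k)))
                / ((1 - q ^+ (2 + 4 * k)) * (1 - q ^+ (4 + 4 * k))).
  have := vr k; rewrite /= mul1r -!exprM => /esym e.
  have {}e : v k * ((1 - q ^+ (1 + 4 * k)) * (1 - q ^+ (3 + 4 * k))) =
     v k.+1 * ((1 - q ^+ (2 + 4 * k)) * (1 - q ^+ (4 + 4 * k))).
    have e4 : (2 * k * 2 = 4 * k)%N by lia.
    by move: e; rewrite e4; move: (4 * k)%N => m; rewrite !exprD expr1.
  by rewrite e mulfK // mulf_neq0 ?om.
rewrite /wz_summand /step_prod !big_ord_recl !big_ord0 !vE v0 /step_ratio /bump /=.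
rewrite ?muln0 ?muln1 ?addn0 ?expr0 ?mul1r.
field.
have om1 : 1 - q != 0 by have := om 1 isT; rewrite expr1.
rewrite !mulNr -expr2 -exprM -!exprD -exprS.
by rewrite q0 om1 !om.
Qed.

(** Induction in steps of 6: the integers prime to 6 are those congruent to
    1 or 5. *)
Lemma sum_at_invpow n N : coprime n 6 -> (n < 2 * N)%N ->
  \sum_(k < N) wz_summand q 1 v (q ^- n) k = target n.
Proof.
elim/ltn_ind: n N => n IH N co nN.
have odd_n := coprime6_odd co.
case: (ltnP n 7) => [n7|n7].
  case: n odd_n n7 nN co {IH} => [|[|[|[|[|[|[|n]]]]]]] //= _ _ nN _.
    exact: sum_one.
  exact: sum_five.
have [m nE] : exists m, n = (m + 6)%N by exists (n - 6)%N; lia.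
rewrite {}nE in IH co nN odd_n n7 *.
have co' : coprime m 6 by move: co; rewrite /coprime gcdnC gcdnDr gcdnC.
have := sum_step co' nN; have mN : (m < 2 * N)%N by lia.
rewrite (IH m _ N co' mN); first last; [lia|].
rewrite -target_step // => /mulIf; apply.
rewrite mulf_neq0 ?expf_neq0 // subr_eq0 eq_sym q_inf //; lia.
Qed.

End PowerPoints.

(** * Polynomials satisfying a dilation equation *)

Lemma poly_all_eq0 (F : numDomainType) (p : {poly F}) : (forall x, p.[x] = 0) -> p = 0.
Proof.
move=> H; apply/eqP/negPn/negP => p0.
have := max_poly_roots (rs := [seq i%:R | i <- iota 0 (size p)]) p0.
rewrite size_map size_iota ltnn map_inj_uniq ?iota_uniq; last first.
  by move=> i j /eqP; rewrite eqr_nat => /eqP.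
suff -> : all (root p) [seq i%:R | i <- iota 0 (size p)] by move=> /(_ isT isT).
by apply/allP => x _; rewrite rootE H.
Qed.

(** Identities between rational functions of a will be checked only where no
    denominator vanishes, that is away from 0 and from the d-th roots of 1. *)
Lemma poly_generic_eq0 (F : numDomainType) (d : nat) (p : {poly F}) : (0 < d)%N ->
  (forall x, x != 0 -> x ^+ d != 1 -> p.[x] = 0) -> p = 0.
Proof.
move=> d0 H; have : p * ('X * ('X^d - 1)) = 0.
  apply: poly_all_eq0 => x; rewrite !hornerM hornerX hornerD hornerN hornerXn hornerC.
  have [->|x0] := eqVneq x 0; first by rewrite !(mul0r, mulr0).
  have [->|x1] := eqVneq (x ^+ d) 1; first by rewrite subrr !(mul0r, mulr0).
  by rewrite H ?mul0r.
move=> /eqP; rewrite mulf_eq0 => /orP[/eqP//|].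
by rewrite mulf_eq0 polyX_eq0 -polyC1 (negPf (monic_neq0 (monicXnsubC 1 d0))).
Qed.

(** The zero b of f gives T(b) = 0 since g(b) is nonzero.  Read backwards, the
    equation then carries each zero x p of T to the zero x, as long as g(x) is
    nonzero.  This yields the n zeros b, b/p, ..., b/p^(n-1), too many for T. *)
Lemma dilation_eq0 (F : fieldType) (T : {poly F}) (p b : F) (f g : F -> F) (n : nat) :
  (size T <= n)%N -> p != 0 -> b != 0 -> (forall j, (0 < j < n)%N -> p ^+ j != 1) ->
  (forall x, T.[x * p] * f x = T.[x] * g x) ->
  f b = 0 -> (forall i, (i < n)%N -> g (b / p ^+ i) != 0) -> T = 0.
Proof.
move=> sT p0 b0 p1 TE fb gb.
have rootT i : (i < n)%N -> T.[b / p ^+ i] = 0.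
  elim: i => [|i IH] lt_i.
    have := TE b; rewrite fb mulr0 => /esym/eqP; rewrite mulf_eq0.
    by have := gb _ lt_i; rewrite expr0 divr1 => /negPf -> /[!orbF] /eqP.
  have := TE (b / p ^+ i.+1).
  have -> : b / p ^+ i.+1 * p = b / p ^+ i by rewrite exprSr invfM mulrA mulfVK.
  rewrite IH ?mul0r; last exact: ltnW.
  by move=> /esym/eqP; rewrite mulf_eq0 (negPf (gb _ lt_i)) orbF => /eqP.
apply/eqP/negPn/negP => T0.
have := max_poly_roots (rs := [seq b / p ^+ i | i <- iota 0 n]) T0.
rewrite size_map size_iota ltnNge sT => H.
suff: false by []; apply: H.
  by apply/allP => x /mapP[i]; rewrite mem_iota => /andP[_ ?] ->; rewrite rootE rootT.
rewrite map_inj_in_uniq ?iota_uniq // => i j; rewrite !mem_iota !add0n /=.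
wlog lt_ij : i j / (i < j)%N.
  move=> W i_n j_n e; case: (ltngtP i j) => // lt; first exact: W.
  by apply/esym; apply: W.
move=> i_n j_n /(mulfI b0) /invr_inj e.
have := p1 (j - i)%N; rewrite subn_gt0 lt_ij (leq_ltn_trans (leq_subr _ _) j_n).
move=> /(_ isT)/negP[]; apply/eqP/(mulfI (expf_neq0 i p0)).
by rewrite -exprD subnKC ?mulr1 // ltnW.
Qed.

(** * Vanishing of a block at a root of unity *)

Section Block.
Variables (F : numFieldType) (q : F) (d : nat).
Hypotheses (d_gt1 : (1 < d)%N) (co_d6 : coprime d 6) (prim_q : d.-primitive_root q).

(** The numerator and the denominator of step_ratio as polynomials in a. *)
Definition num_factor (Y : F) : {poly F} :=
  ((q * Y) ^+ 2) *: ((1 - (q * Y)%:P * 'X) * ('X - (q * Y)%:P)).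

Definition den_factor (Y : F) : {poly F} :=
  (1 - (q ^+ 6 * Y ^+ 3)%:P * 'X) * ('X - (q ^+ 6 * Y ^+ 3)%:P).

Definition den_poly (y : F) (K : nat) : {poly F} :=
  \prod_(l < K) den_factor (y * q ^+ (2 * l)).

(** The sum of the first K + 1 summands of a block, times its common
    denominator den_poly, as a polynomial in a. *)
Definition block_poly (y : F) (v : nat -> F) (K : nat) : {poly F} :=
  \sum_(k < K.+1) (v k * (1 - q * (y * q ^+ (2 * k)) ^+ 4)) *:
    (\prod_(l < K) if (l < k)%N then num_factor (y * q ^+ (2 * l))
                   else den_factor (y * q ^+ (2 * l))).

Lemma q_neq0 : q != 0.
Proof.
apply/eqP => q0; have := prim_expr_order prim_q.
by move/eqP; rewrite q0 expr0n; case: d d_gt1 => //= ? _; rewrite eq_sym oner_eq0.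
Qed.

Lemma q_expd : q ^+ d = 1. Proof. exact: prim_expr_order. Qed.

Lemma size_quadratic (c : F) : (size ((1 - c%:P * 'X) * ('X - c%:P))%R <= 3)%N.
Proof.
apply: leq_trans (size_polyMleq _ _) _; rewrite size_XsubC addn2 /= ltnS.
apply: leq_trans (size_polyD _ _) _; rewrite geq_max size_poly1 size_polyN /=.
by rewrite mul_polyC; apply: leq_trans (size_scale_leq _ _) _; rewrite size_polyX.
Qed.

(** Every product has K factors of degree at most 2. *)
Lemma size_block_poly y v K : (size (block_poly y v K) <= (2 * K).+1)%N.
Proof.
apply: leq_trans (size_sum _ _ _) _; apply/bigmax_leqP => k _.
apply: leq_trans (size_scale_leq _ _) _.
apply: leq_trans (size_prod_leq _ _) _; rewrite card_ord leq_subLR addnS ltnS.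
have -> : (K + 2 * K = \sum_(l < K) 3)%N by rewrite sum_nat_const card_ord; lia.
apply: leq_sum => l _; case: ifP => _; last exact: size_quadratic.
exact: leq_trans (size_scale_leq _ _) (size_quadratic _).
Qed.

Lemma horner_den_factor Y x :
  (den_factor Y).[x] = (1 - x * q ^+ 6 * Y ^+ 3) * (x - q ^+ 6 * Y ^+ 3).
Proof. by rewrite /den_factor !(hornerM, hornerD, hornerN, hornerC, hornerX); ring. Qed.

Lemma horner_num_factor Y x : (den_factor Y).[x] != 0 ->
  (num_factor Y).[x] = step_ratio q x Y * (den_factor Y).[x].
Proof.
rewrite horner_den_factor mulf_eq0 negb_or => /andP[n1 n2].
by rewrite /num_factor /step_ratio !(hornerZ, hornerM, hornerD, hornerN, hornerC, hornerX); field; rewrite n1 n2.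
Qed.

Lemma horner_den_poly_neq0 y K x : regular q y x -> (den_poly y K).[x] != 0.
Proof.
move=> reg; rewrite /den_poly horner_prod; apply/prodf_neq0 => l _.
by have [n1 n2] := reg l; rewrite horner_den_factor mulf_neq0.
Qed.

Lemma horner_block_poly y v K x : regular q y x ->
  (block_poly y v K).[x] = (den_poly y K).[x] * \sum_(k < K.+1) wz_summand q y v x k.
Proof.
move=> reg; rewrite /block_poly horner_sum mulr_sumr; apply: eq_bigr => k _.
rewrite hornerZ horner_prod /wz_summand -[step_prod _ _ _ _ * _ * _]mulrA [RHS]mulrA [RHS]mulrC.
congr (_ * _).
have le_kK : (k <= K)%N by rewrite -ltnS.
rewrite /den_poly horner_prod /step_prod (big_ord_widen K (fun l => step_ratio q x (y * q ^+ (2 * l)))) //.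
rewrite [X in _ * X]big_mkcond -big_split; apply: eq_bigr => l _ /=.
have [n1 n2] := reg l.
have dn : (den_factor (y * q ^+ (2 * l))).[x] != 0 by rewrite horner_den_factor mulf_neq0.
case: ifP => _; last by rewrite mulr1.
by rewrite horner_num_factor // mulrC.
Qed.

(** Both sequences of linear factors telescope under a -> a q^6. *)
Lemma den_poly_shift y K x :
  (den_poly y K).[x * q ^+ 6] * ((1 - x * q ^+ 6 * y ^+ 3) * (x - q ^+ (6 * K) * y ^+ 3)) =
  (den_poly y K).[x] * (1 - x * q ^+ (6 * K + 6) * y ^+ 3) * (x - y ^+ 3) * q ^+ (6 * K).
Proof.
rewrite /den_poly; elim: K => [|K IH].
  by rewrite !big_ord0 !hornerC muln0 expr0; ring.
rewrite !big_ord_recr /= hornerM [in RHS]hornerM !horner_den_factor mulnS.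
have e6 : (6 * K = 2 * K * 3)%N by lia.
move: IH; rewrite e6 !(exprD q _ 6) (exprD q 6) !(exprM q _ 3); move: (q ^+ (2 * K)) => u.
move: ((\prod_(l < K) _).[_]) ((\prod_(l < K) _).[_]) => A B IH.
have -> : B * ((1 - x * q ^+ 6 * q ^+ 6 * (y * u) ^+ 3) * (x * q ^+ 6 - q ^+ 6 * (y * u) ^+ 3)) *
  ((1 - x * q ^+ 6 * y ^+ 3) * (x - q ^+ 6 * u ^+ 3 * y ^+ 3)) =
  B * ((1 - x * q ^+ 6 * y ^+ 3) * (x - u ^+ 3 * y ^+ 3)) *
  ((1 - x * q ^+ 6 * q ^+ 6 * (y * u) ^+ 3) * q ^+ 6 * (x - q ^+ 6 * u ^+ 3 * y ^+ 3)).
  ring.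
rewrite IH; ring.
Qed.

(** wz_sum after multiplication by the denominators.  The boundary terms vanish
    at the beginning of the block because of y, and at its end because of v. *)
Lemma block_poly_shift y v K x : two_step_rec q y v -> v K.+1 = 0 ->
  (1 - y ^+ 2) * (q ^+ 2 - y ^+ 2) = 0 ->
  generic q y x -> regular q y (x * q ^+ 6) ->
  (block_poly y v K).[x * q ^+ 6] *
    (q ^+ 3 * (1 - x * q * y) * (1 - x * q ^+ 3 * y) * (1 - x * q ^+ 5 * y)
     * (x - q ^+ (6 * K) * y ^+ 3)) =
  (block_poly y v K).[x] *
    ((x * q ^+ 5 - y) * (x * q ^+ 3 - y) * (x * q - y)
     * q ^+ (6 * K) * (1 - x * q ^+ (6 * K + 6) * y ^+ 3)).
Proof.
move=> vr vK y2 gen reg'; have [reg gen2] := gen.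
rewrite !horner_block_poly //.
have := @wz_sum F q q_neq0 y v x K.+1 vr gen reg'.
rewrite {1}/certificate vK mulr0 mul0r addr0.
rewrite /certificate muln0 expr0 mulr1 y2 !mul0r mulr0 subr0 => <-.
have [n1 n2] := reg 0; have [n3 n4 n5] := gen2 0.
move: n1 n2 n3 n4 n5; rewrite muln0 expr0 mulr1 => n1 n2 n3 n4 n5.
have := den_poly_shift y K x; move: (_.[_]) (_.[_]) (q ^+ (6 * K)) (q ^+ (6 * K + 6)).
move=> B A u u6; move: (\sum_(_ < _) _) => s e.
have {}e : A * (x - u * y ^+ 3) = B * (1 - x * u6 * y ^+ 3) * (x - y ^+ 3) * u
   / (1 - x * q ^+ 6 * y ^+ 3) by rewrite -e; field.
have -> : forall z, A * s * (z * (x - u * y ^+ 3)) = A * (x - u * y ^+ 3) * (s * z).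
  by move=> z; ring.
by rewrite e /rho; field; rewrite n1 n3 n4 n5.
Qed.

Lemma pow_eq1 i : (q ^+ i == 1) = (d %| i)%N.
Proof. by rewrite -(prim_order_dvd prim_q). Qed.

(** All the poles of the summands, of rho and of the certificate are powers of
    q, hence d-th roots of unity. *)
Lemma generic_outside i x : x != 0 -> x ^+ d != 1 -> generic q (q ^+ i) x.
Proof.
move=> x0 xd.
have H j k : x * q ^+ j != q ^+ k.
  apply: contra xd => /eqP /(congr1 (fun z => z ^+ d)).
  by rewrite exprMn -!exprM ![(_ * d)%N]mulnC !exprM q_expd !expr1n mulr1 => ->.
have e j k : (q ^+ i * q ^+ (2 * j)) ^+ k = q ^+ ((i + 2 * j) * k).
  by rewrite -exprD exprM.
have e1 j : q ^+ i * q ^+ (2 * j) = q ^+ (i + 2 * j) by rewrite exprD.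
split=> k /=.
  rewrite e -mulrA -!exprD; split.
    by rewrite subr_eq0 eq_sym -[1]/(q ^+ 0) H.
  by rewrite subr_eq0 -[x]mulr1 -[1]/(q ^+ 0) H.
by rewrite e1 -{1}[q]expr1 !subr_eq0 !H.
Qed.

(** An equation known outside 0 and the d-th roots of unity is an identity of
    polynomials, and so holds at the powers of q, where dilation_eq0 needs it. *)
Lemma dilation_identity (T P Q : {poly F}) c :
  (forall x, x != 0 -> x ^+ d != 1 -> T.[x * c] * P.[x] = T.[x] * Q.[x]) ->
  forall x, T.[x * c] * P.[x] = T.[x] * Q.[x].
Proof.
move=> H x; have d0 : (0 < d)%N by apply: ltnW.
have : (T \Po ('X * c%:P)) * P - T * Q = 0.
  apply: (poly_generic_eq0 d0) => z z0 zd.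
  by rewrite hornerD hornerN !hornerM horner_comp hornerM hornerX hornerC H ?subrr.
move/(congr1 (fun p => p.[x])).
rewrite hornerD hornerN !hornerM horner_comp hornerM hornerX hornerC horner0.
by move/eqP; rewrite subr_eq0 => /eqP.
Qed.

Lemma pow6_neq1 j : (0 < j < d)%N -> q ^+ (6 * j) != 1.
Proof.
move=> /andP[j0 jd]; rewrite pow_eq1 Gauss_dvdr // gtnNdvd //.
Qed.

Lemma pow6_gap i j : (i < j < i + d)%N -> q ^+ (6 * i) != q ^+ (6 * j).
Proof.
move=> ij; have -> : (6 * j = 6 * i + 6 * (j - i))%N by lia.
rewrite exprD -{1}[q ^+ (6 * i)]mulr1 (inj_eq (mulfI _)) ?expf_neq0 ?q_neq0 //.
by rewrite eq_sym pow6_neq1 //; lia.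
Qed.

Lemma pow3_gap i j : (j < i + d)%N -> (i < j + d)%N -> odd i != odd j ->
  q ^+ (3 * i) != q ^+ (3 * j).
Proof.
wlog lt_ij : i j / (i < j)%N.
  move=> W di dj oij; case: (ltngtP i j) => [lt|lt|e]; first exact: W.
    by rewrite eq_sym; apply: W; rewrite // eq_sym.
  by rewrite e eqxx in oij.
move=> di dj oij; have -> : (3 * j = 3 * i + 3 * (j - i))%N by lia.
rewrite exprD -{1}[q ^+ (3 * i)]mulr1 (inj_eq (mulfI _)) ?expf_neq0 ?q_neq0 //.
have co3 : coprime d 3 by move: co_d6; rewrite (@coprimeMr d 2 3) => /andP[].
by rewrite eq_sym pow_eq1 Gauss_dvdr // gtnNdvd //; lia.
Qed.

(** A block starting at Y = 1.  After cancelling the common factors of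
    block_poly_shift, f has its zero at q^(6K) and the zero of g is
    q^(-6(K+1)), which is not among the 2K + 1 points q^(6K-6i). *)
Lemma block_poly_eq0_even v K : two_step_rec q 1 v -> v K.+1 = 0 -> (2 * K + 1 < d)%N ->
  block_poly 1 v K = 0.
Proof.
move=> vr vK Kd; have q0 := q_neq0.
pose P : {poly F} := (- q ^+ 3)%:P * ('X - (q ^+ (6 * K))%:P).
pose Q : {poly F} := (q ^+ (6 * K))%:P * (1 - 'X * (q ^+ (6 * K + 6))%:P).
have PE x : P.[x] = - q ^+ 3 * (x - q ^+ (6 * K)).
  by rewrite /P !(hornerM, hornerD, hornerN, hornerC, hornerX).
have QE x : Q.[x] = q ^+ (6 * K) * (1 - x * q ^+ (6 * K + 6)).
  by rewrite /Q !(hornerM, hornerD, hornerN, hornerC, hornerX).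
apply: (@dilation_eq0 _ _ (q ^+ 6) (q ^+ (6 * K)) (horner P) (horner Q) (2 * K).+1).
- exact: size_block_poly.
- by rewrite expf_neq0.
- by rewrite expf_neq0.
- by move=> j j0; rewrite -exprM pow6_neq1 //; lia.
- apply: dilation_identity => x x0 xd; rewrite PE QE.
  have gen i := @generic_outside i x x0 xd.
  have xd6 : (x * q ^+ 6) ^+ d != 1 by rewrite exprMn -exprM mulnC exprM q_expd expr1n mulr1.
  have reg' : regular q 1 (x * q ^+ 6).
    by have [] := @generic_outside 0 (x * q ^+ 6) (mulf_neq0 x0 (expf_neq0 6 q0)) xd6.
  have gen0 : generic q 1 x := gen 0.
  have := block_poly_shift vr vK _ gen0 reg'.
  rewrite !expr1n subrr mul0r !mulr1 => /(_ erefl).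
  have [_ /(_ 0)] := gen0; rewrite muln0 mulr1 => -[n1 n3 n5].
  set A := _.[_]; set B := _.[_]; move=> e.
  (* x q - 1, x q^3 - 1 and x q^5 - 1 are common to both sides up to sign. *)
  apply: (mulfI (mulf_neq0 n1 (mulf_neq0 n3 n5))).
  move: e; set u := q ^+ (6 * K); set u6 := q ^+ (_ + _) => e.
  have -> : (x * q - 1) * ((x * q ^+ 3 - 1) * (x * q ^+ 5 - 1)) * (A * (- q ^+ 3 * (x - u))) =
     A * (q ^+ 3 * (1 - x * q) * (1 - x * q ^+ 3) * (1 - x * q ^+ 5) * (x - u)) by ring.
  rewrite e; ring.
- by rewrite PE subrr mulr0.
move=> i iK; rewrite QE mulf_neq0 ?expf_neq0 // subr_eq0 eq_sym -exprM mulrAC -exprD.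
rewrite -(inj_eq (mulIf (expf_neq0 (6 * i) q0))) mulfVK ?expf_neq0 // mul1r eq_sym.
rewrite (_ : 6 * K + (6 * K + 6) = 6 * (2 * K).+1)%N; last lia.
by apply: pow6_gap; lia.
Qed.

(** A block starting at Y = q.  Here f has the zero q^(6K+3), and the zeros
    1 and q^(-6K-9) of g avoid the points q^(6K+3-6i): the first because
    2K + 1 - 2i is odd and smaller than d in absolute value. *)
Lemma block_poly_eq0_odd v K : two_step_rec q q v -> v K.+1 = 0 -> (2 * K + 2 < d)%N ->
  block_poly q v K = 0.
Proof.
move=> vr vK Kd; have q0 := q_neq0.
pose P : {poly F} := (1 - 'X * (q ^+ 6)%:P) * ('X - (q ^+ (6 * K) * q ^+ 3)%:P).
pose Q : {poly F} := ('X - 1) * (q ^+ (6 * K))%:P * (1 - 'X * (q ^+ (6 * K + 6) * q ^+ 3)%:P).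
have PE x : P.[x] = (1 - x * q ^+ 6) * (x - q ^+ (6 * K) * q ^+ 3).
  by rewrite /P !(hornerM, hornerD, hornerN, hornerC, hornerX).
have QE x : Q.[x] = (x - 1) * q ^+ (6 * K) * (1 - x * (q ^+ (6 * K + 6) * q ^+ 3)).
  by rewrite /Q !(hornerM, hornerD, hornerN, hornerC, hornerX).
apply: (@dilation_eq0 _ _ (q ^+ 6) (q ^+ (6 * K) * q ^+ 3) (horner P) (horner Q) (2 * K).+1).
- exact: size_block_poly.
- by rewrite expf_neq0.
- by rewrite mulf_neq0 ?expf_neq0.
- by move=> j j0; rewrite -exprM pow6_neq1 //; lia.
- apply: dilation_identity => x x0 xd; rewrite PE QE.
  have gen i := @generic_outside i x x0 xd.
  have xd6 : (x * q ^+ 6) ^+ d != 1 by rewrite exprMn -exprM mulnC exprM q_expd expr1n mulr1.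
  have reg' : regular q q (x * q ^+ 6).
    by have [] := @generic_outside 1 (x * q ^+ 6) (mulf_neq0 x0 (expf_neq0 6 q0)) xd6.
  have gen1 : generic q q x := gen 1.
  have := block_poly_shift vr vK _ gen1 reg'; rewrite subrr mulr0 => /(_ erefl).
  have [_ /(_ 0)] := gen1; rewrite muln0 expr0 mulr1 => -[_ n3 n5].
  set A := _.[_]; set B := _.[_]; move=> e.
  (* 1 - x q^2 and 1 - x q^4 are common to both sides up to a power of q. *)
  apply: (mulfI (mulf_neq0 q0 (mulf_neq0 n3 n5))).
  move: e; set u := q ^+ (6 * K); set u6 := q ^+ (_ + _) => e.
  have -> : q * ((x * q ^+ 3 - q) * (x * q ^+ 5 - q)) *
     (A * ((1 - x * q ^+ 6) * (x - u * q ^+ 3))) =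
     A * (q ^+ 3 * (1 - x * q * q) * (1 - x * q ^+ 3 * q) * (1 - x * q ^+ 5 * q)
       * (x - u * q ^+ 3)) by ring.
  rewrite e; ring.
- by rewrite PE subrr mulr0.
move=> i iK; rewrite QE -!exprD -exprM !mulf_neq0 ?expf_neq0 //.
  rewrite subr_eq0 -(inj_eq (mulIf (expf_neq0 (6 * i) q0))) mulfVK ?expf_neq0 // mul1r.
  have -> : (6 * K + 3 = 3 * (2 * K).+1)%N by lia.
  have -> : (6 * i = 3 * (2 * i))%N by lia.
  by apply: pow3_gap; lia.
rewrite subr_eq0 mulrAC -exprD eq_sym.
rewrite -(inj_eq (mulIf (expf_neq0 (6 * i) q0))) mulfVK ?expf_neq0 // mul1r eq_sym.
rewrite (_ : 6 * K + 3 + (6 * K + 6 + 3) = 6 * (2 * K).+2)%N; last lia.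
by apply: pow6_gap; lia.
Qed.

End Block.

(** * Vanishing of the whole sum at a root of unity *)

Lemma step_prod_add (F : fieldType) (q a : F) k i :
  step_prod q 1 a (k + i) = step_prod q 1 a k * step_prod q (q ^+ (2 * k)) a i.
Proof.
rewrite /step_prod big_split_ord /=; congr (_ * _); apply: eq_bigr => l _.
by rewrite mul1r mulnDr exprD.
Qed.

Lemma wz_summand_add (F : fieldType) (q a : F) v k i :
  wz_summand q 1 v a (k + i) =
  step_prod q 1 a k * wz_summand q (q ^+ (2 * k)) (fun i => v (k + i)%N) a i.
Proof. by rewrite /wz_summand step_prod_add mul1r mulnDr exprD -!mulrA. Qed.

Lemma two_step_rec_add (F : fieldType) (q : F) v k :
  two_step_rec q 1 v -> two_step_rec q (q ^+ (2 * k)) (fun i => v (k + i)%N).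
Proof. by move=> vr i; have := vr (k + i)%N; rewrite /= mul1r addnS mulnDr exprD. Qed.

(** The recurrence of v_j = (q;q^2)_j / (q^2;q^2)_j. *)
Definition one_step_rec (F : fieldType) (q : F) (v : nat -> F) : Prop :=
  forall j, v j.+1 * (1 - q ^+ (2 * j).+2) = v j * (1 - q ^+ (2 * j).+1).

Lemma one_step_rec_two_step (F : fieldType) (q : F) v :
  one_step_rec q v -> two_step_rec q 1 (fun k => v (2 * k)%N).
Proof.
move=> hr k; have := hr (2 * k)%N; have := hr (2 * k).+1; rewrite /= mul1r.
have -> : (2 * k.+1 = (2 * k).+2)%N by lia.
have -> : ((2 * (2 * k).+1).+2 = 2 * k * 2 + 4)%N by lia.
have -> : ((2 * (2 * k).+1).+1 = 2 * k * 2 + 3)%N by lia.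
have -> : ((2 * (2 * k)).+2 = 2 * k * 2 + 2)%N by lia.
have -> : ((2 * (2 * k)).+1 = 2 * k * 2 + 1)%N by lia.
rewrite !(exprD q (2 * k * 2)) expr1 !(exprM q _ 2).
move: (q ^+ (2 * k)) (v _) (v _) (v _) => u c b a e1 e2.
transitivity (a * (1 - u ^+ 2 * q ^+ 4) * (1 - u ^+ 2 * q ^+ 2)); first by ring.
rewrite e1.
transitivity (b * (1 - u ^+ 2 * q ^+ 2) * (1 - u ^+ 2 * q ^+ 3)); first by ring.
by rewrite e2; ring.
Qed.

Section RootOfUnity.
Variables (F : numFieldType) (q : F) (d : nat).
Hypotheses (d_gt1 : (1 < d)%N) (co_d6 : coprime d 6) (prim_q : d.-primitive_root q).
Variable v : nat -> F.
Hypothesis vr : one_step_rec q v.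
Let m := d./2.

(** At j = l d + (d-1)/2 the factor 1 - q^(2j+1) vanishes, and the value 0
    persists until 1 - q^(2j+2) vanishes in turn at the next multiple of d. *)
Lemma one_step_rec_eq0 l r : (m < r < d)%N -> v (l * d + r) = 0.
Proof.
have odd_d := coprime6_odd co_d6.
have dE : d = (2 * m).+1 by rewrite /m; lia.
have nz i : (0 < i < d)%N -> 1 - q ^+ (2 * (l * d + i)) != 0.
  move=> i0; rewrite subr_eq0 eq_sym (pow_eq1 prim_q) Gauss_dvdr; last first.
    by rewrite coprimen2.
  by rewrite dvdn_addr ?dvdn_mull // gtnNdvd //; lia.
elim: r => [|r IH] // /andP[mr rd].
have e := vr (l * d + r).
have {}e : v (l * d + r.+1) * (1 - q ^+ (2 * (l * d + r.+1))) =
           v (l * d + r) * (1 - q ^+ (2 * (l * d + r)).+1).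
  by rewrite addnS -e; congr (_ * (1 - q ^+ _)); lia.
have /eqP : v (l * d + r.+1) * (1 - q ^+ (2 * (l * d + r.+1))) = 0.
  rewrite e; have [rm|mr'] := leqP r m; last first.
    by rewrite IH ?mul0r //; lia.
  have -> : ((2 * (l * d + r)).+1 = d * (2 * l).+1)%N by rewrite mulnS; lia.
  by rewrite exprM (q_expd prim_q) expr1n subrr mulr0.
by rewrite mulf_eq0 (negPf (nz _ _)) ?orbF => [/eqP//|]; lia.
Qed.

Lemma sum_block_trunc y w x K N : (K < N)%N -> (forall i, (K < i < N)%N -> w i = 0) ->
  \sum_(k < N) wz_summand q y w x k = \sum_(k < K.+1) wz_summand q y w x k.
Proof.
move=> KN w0.
rewrite -!(big_mkord xpredT (wz_summand q y w x)) (big_cat_nat (leq0n _) KN) /=.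
rewrite [X in _ + X]big_nat_cond [X in _ + X]big1 ?addr0 // => k /andP[/andP[lk kN] _].
by rewrite /wz_summand w0 ?mulr0 ?mul0r // lk.
Qed.

Variable x : F.
Hypotheses (x0 : x != 0) (xd : x ^+ d != 1).
Let t k := wz_summand q 1 (fun k => v (2 * k)%N) x k.

(** The block starts at q^(2k) = 1, and its v vanishes from the index
    K + 1 on, for K = floor(m/2). *)
Lemma even_block l : \sum_(i < m.+1) t (l * d + i) = 0.
Proof.
have odd_d := coprime6_odd co_d6.
have d5 : (4 < d)%N by case: d d_gt1 co_d6 => [|[|[|[|[|]]]]].
have dE : d = (2 * m).+1 by rewrite /m; lia.
pose w i := v (2 * (l * d + i))%N.
have w0 i : (m./2 < i < m.+1)%N -> w i = 0.
  move=> i0; rewrite /w mulnDr mulnA one_step_rec_eq0 //; lia.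
under eq_bigr do rewrite /t wz_summand_add.
have y1 : q ^+ (2 * (l * d)) = 1 by rewrite (mulnC l) mulnCA exprM (q_expd prim_q) expr1n.
rewrite -mulr_sumr y1 -[X in _ * X]/(\sum_(i < m.+1) wz_summand q 1 w x i).
rewrite (@sum_block_trunc _ w _ m./2) //; last by lia.
have [reg _] := @generic_outside _ _ _ prim_q 0 x x0 xd.
have vw : two_step_rec q 1 w.
  by have := two_step_rec_add (l * d) (one_step_rec_two_step vr); rewrite y1.
suff -> : \sum_(k < (m./2).+1) wz_summand q 1 w x k = 0 by rewrite mulr0.
apply: (mulfI (horner_den_poly_neq0 m./2 reg)).
rewrite -horner_block_poly // mulr0 (block_poly_eq0_even d_gt1 co_d6 prim_q) ?horner0 //; try lia.
by apply: w0; lia.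
Qed.

(** The block starts at q^(2k) = q, and its v vanishes from the index
    K + 1 on, for K = floor((m-1)/2). *)
Lemma odd_block l : \sum_(i < m) t (l * d + m.+1 + i) = 0.
Proof.
have odd_d := coprime6_odd co_d6.
have d5 : (4 < d)%N by case: d d_gt1 co_d6 => [|[|[|[|[|]]]]].
have dE : d = (2 * m).+1 by rewrite /m; lia.
pose w i := v (2 * (l * d + m.+1 + i))%N.
pose K := (m.-1)./2.
have w0 i : (K < i < m)%N -> w i = 0.
  move=> i0; rewrite /w (_ : 2 * _ = (2 * l).+1 * d + (2 * i).+1)%N.
    by rewrite one_step_rec_eq0 //; move: i0; rewrite /K; lia.
  by rewrite mulSn; lia.
have w1 : w K.+1 = 0.
  rewrite /w (_ : 2 * _ = (2 * l).+1 * d + (2 * K.+1).+1)%N.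
    by rewrite one_step_rec_eq0 // /K; lia.
  by rewrite mulSn; lia.
under eq_bigr do rewrite /t wz_summand_add.
have yq : q ^+ (2 * (l * d + m.+1)) = q.
  have -> : (2 * (l * d + m.+1) = d * (2 * l).+1 + 1)%N by rewrite mulnS; lia.
  by rewrite exprD exprM (q_expd prim_q) expr1n mul1r expr1.
rewrite -mulr_sumr yq -[X in _ * X]/(\sum_(i < m) wz_summand q q w x i).
rewrite (@sum_block_trunc _ w _ K) //; last by rewrite /K; lia.
have [reg _] := @generic_outside _ _ _ prim_q 1 x x0 xd.
have vw : two_step_rec q q w.
  by have := two_step_rec_add (l * d + m.+1) (one_step_rec_two_step vr); rewrite yq.
suff -> : \sum_(k < K.+1) wz_summand q q w x k = 0 by rewrite mulr0.
apply: (mulfI (horner_den_poly_neq0 K reg)).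
rewrite -horner_block_poly // mulr0 (block_poly_eq0_odd d_gt1 co_d6 prim_q) ?horner0 //.
by rewrite /K; lia.
Qed.

(** Both the range k < n and the range k <= (n-1)/2 have one of these two forms,
    with L = n/d in the first and L = floor(n/(2d)) in the second. *)
Lemma sum_blocks L :
  \sum_(k < L * d) t k = 0 /\ \sum_(k < L * d + m.+1) t k = 0.
Proof.
have odd_d := coprime6_odd co_d6.
have dE : d = (m.+1 + m)%N by rewrite /m; lia.
suff H : \sum_(k < L * d) t k = 0.
  by split=> //; rewrite big_split_ord /= H add0r even_block.
elim: L => [|L IH]; first by rewrite big_ord0.
have -> : (L.+1 * d = L * d + m.+1 + m)%N by lia.
by rewrite !big_split_ord /= IH even_block odd_block !addr0.
Qed.
End RootOfUnity.

(** * Integrality of the central coefficients *)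

Fixpoint qbinomial (R : comNzRingType) (q : R) (n k : nat) : R :=
  match n, k with
  | _, 0 => 1
  | 0, _.+1 => 0
  | n'.+1, k'.+1 => qbinomial q n' k' + q ^+ k * qbinomial q n' k
  end.

Section QBinomial.
Variables (R : comNzRingType) (q : R).

Lemma qbinomial0 n : qbinomial q n 0 = 1. Proof. by case: n. Qed.

Lemma qbinomial_small n k : (n < k)%N -> qbinomial q n k = 0.
Proof.
elim: n k => [|n IH] [|k] //= lt.
by rewrite !IH ?mulr0 ?addr0 // ltnW.
Qed.

(** Together with qbinomial_diag, this is proved from the Pascal rule without
    cancelling a factor 1 - q^i, hence in every commutative ring; the value of q
    may be a root of unity. *)
Lemma qbinomial_down n k : (k <= n)%N ->
  (1 - q ^+ k.+1) * qbinomial q n k.+1 = (1 - q ^+ (n - k)) * qbinomial q n k.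
Proof.
elim: n k => [|n IH] [|k] //=; first by rewrite subrr mulr0 mul0r.
  move=> _; rewrite qbinomial0 mulrDr mulrCA IH // qbinomial0 !mulr1 expr1 subn0 subn0.
  by rewrite exprS; ring.
rewrite ltnS => kn; rewrite subSS.
have [kn'|nk] := ltnP k n; last first.
  have -> : k = n by apply/eqP; rewrite eqn_leq kn nk.
  by rewrite subnn expr0 subrr mul0r !qbinomial_small ?mulr0 ?addr0 ?mulr0.
rewrite mulrDr mulrCA IH // mulrDr mulrCA.
have e2 : (n - k = (n - k.+1).+1)%N by lia.
have e3 := IH k kn; rewrite e2 in e3 *; rewrite -e3 (exprS q k.+1) (exprS q (n - _)).
by move: (q ^+ k.+1) (q ^+ (n - k.+1)) (qbinomial _ _ _) => u w b; ring.
Qed.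

Lemma qbinomial_diag n k : (k <= n)%N ->
  (1 - q ^+ k.+1) * qbinomial q n.+1 k.+1 = (1 - q ^+ n.+1) * qbinomial q n k.
Proof.
move=> kn; rewrite /= mulrDr mulrCA qbinomial_down //.
have -> : q ^+ n.+1 = q ^+ (n - k) * q ^+ k.+1 by rewrite -exprD; congr (_ ^+ _); lia.
by move: (q ^+ k.+1) (q ^+ (n - k)) (qbinomial _ _ _) => u w b; ring.
Qed.

Definition central_qbinomial (j : nat) : R := qbinomial q (2 * j) j.

(** Multiplication by 1 - q^(j+1) leads from [2j choose j] to [2j+1 choose j]
    and, once more, to [2j+2 choose j+1]. *)
Lemma central_qbinomialS j :
  (1 - q ^+ j.+1) * central_qbinomial j.+1 =
  (1 + q ^+ j.+1) * (1 - q ^+ (2 * j).+1) * central_qbinomial j.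
Proof.
rewrite /central_qbinomial (_ : 2 * j.+1 = (2 * j).+2)%N; last lia.
rewrite qbinomial_diag; last lia.
rewrite -[RHS]mulrA.
have <- : (1 - q ^+ j.+1) * qbinomial q (2 * j).+1 j =
          (1 - q ^+ (2 * j).+1) * qbinomial q (2 * j) j.
  rewrite -(qbinomial_diag (n := 2 * j)); last lia.
  rewrite qbinomial_down; last lia.
  by congr ((1 - q ^+ _) * _); lia.
rewrite mulrA; congr (_ * _).
rewrite (_ : (2 * j).+2 = j.+1 * 2)%N ?exprM; last lia.
by ring.
Qed.
End QBinomial.

Definition neg_poch_sq (R : comNzRingType) (q : R) (j : nat) : R :=
  \prod_(i < j) (1 + q ^+ i.+1) ^+ 2.

(** The coefficient v_j in a form that makes sense when q is a root of unity
    of odd order; half_pochE compares it with the quotient of q-shifted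
    factorials. *)
Definition half_poch (F : fieldType) (q : F) (j : nat) : F :=
  central_qbinomial q j / neg_poch_sq q j.

Section HalfPoch.
Variables (F : fieldType) (q : F).
Hypothesis qN : forall i, 1 + q ^+ i.+1 != 0.

Lemma neg_poch_sq_neq0 j : neg_poch_sq q j != 0.
Proof. by apply/prodf_neq0 => i _; rewrite expf_neq0. Qed.

Lemma half_poch_rec : one_step_rec q (half_poch q).
Proof.
move=> j; rewrite /half_poch /neg_poch_sq big_ord_recr /= -/(neg_poch_sq q j).
have p0 := neg_poch_sq_neq0 j; have n1 := qN j; have e := central_qbinomialS q j.
have -> : 1 - q ^+ (2 * j).+2 = (1 + q ^+ j.+1) * (1 - q ^+ j.+1).
  by rewrite (_ : (2 * j).+2 = j.+1 * 2)%N ?exprM; [ring | lia].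
transitivity ((1 - q ^+ j.+1) * central_qbinomial q j.+1 / (neg_poch_sq q j * (1 + q ^+ j.+1))).
  by field; rewrite p0 n1.
by rewrite e; field; rewrite p0 n1.
Qed.

Lemma half_pochE j : (forall i, 1 - q ^+ (2 * i.+1) != 0) ->
  qpoch q (q ^+ 2) j / qpoch (q ^+ 2) (q ^+ 2) j = half_poch q j.
Proof.
move=> q2; elim: j => [|j IH].
  by rewrite /qpoch /half_poch /neg_poch_sq !big_ord0 /central_qbinomial.
have : half_poch q j.+1 * (1 - q ^+ (2 * j.+1)) = half_poch q j * (1 - q ^+ (2 * j).+1).
  by rewrite -half_poch_rec; congr (_ * (1 - q ^+ _)); lia.
move/(canRL (mulfK (q2 j))) => ->; rewrite -IH /qpoch !big_ord_recr /= -exprM -exprS.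
rewrite -exprD -mulnS; rewrite invfM; ring.
Qed.

End HalfPoch.

(** * Clearing denominators *)

Section Numerator.
Variable (n N : nat).

(** Numerator and denominator of the l-th factor of step_prod at y = 1. *)
Definition num_step (R : comNzRingType) (q a : R) (l : nat) : R :=
  (q * q ^+ (2 * l)) ^+ 2 * ((1 - a * q * q ^+ (2 * l)) * (a - q * q ^+ (2 * l))).

Definition den_step (R : comNzRingType) (q a : R) (l : nat) : R :=
  (1 - a * q ^+ (6 * l.+1)) * (a - q ^+ (6 * l.+1)).

Definition qint (R : comNzRingType) (q : R) (k : nat) : R := \sum_(j < k) q ^+ j.

Definition denominator (R : comNzRingType) (q a : R) : R :=
  q ^+ n./2 * neg_poch_sq q (2 * N) * \prod_(l < N) den_step q a l.

(** The difference of the two sides of the congruence times denominator.  It is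
    a polynomial expression over any commutative ring, so that ring morphisms
    carry it from Z[q][a] to each field where it has to be evaluated. *)
Definition numerator (R : comNzRingType) (q a : R) : R :=
  q ^+ n./2 * (\sum_(k < N)
    (\prod_(l < N) if (l < k)%N then num_step q a l else den_step q a l) *
    (central_qbinomial q (2 * k) *
     \prod_(i < 2 * N) if (i < 2 * k)%N then 1 else (1 + q ^+ i.+1) ^+ 2) *
    qint q (8 * k + 1))
  - neg_poch_sq q (2 * N) * (\prod_(l < N) den_step q a l) * qint q n * (char3 n)%:~R.

Section Morphism.
Variables (R S : comNzRingType) (f : {rmorphism R -> S}) (q a : R).

Lemma rmorph_num_step l : f (num_step q a l) = num_step (f q) (f a) l.
Proof. by rewrite /num_step !(rmorphM, rmorphB, rmorphXn, rmorph1). Qed.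

Lemma rmorph_den_step l : f (den_step q a l) = den_step (f q) (f a) l.
Proof. by rewrite /den_step !(rmorphM, rmorphB, rmorphXn, rmorph1). Qed.

Lemma rmorph_qint k : f (qint q k) = qint (f q) k.
Proof. by rewrite rmorph_sum; apply: eq_bigr => i _; rewrite rmorphXn. Qed.

Lemma rmorph_qbinomial m k : f (qbinomial q m k) = qbinomial (f q) m k.
Proof.
elim: m k => [|m IH] [|k] /=; rewrite ?rmorph0 ?rmorph1 //.
by rewrite rmorphD rmorphM rmorphXn !IH.
Qed.

Lemma rmorph_neg_poch_sq j : f (neg_poch_sq q j) = neg_poch_sq (f q) j.
Proof.
by rewrite rmorph_prod; apply: eq_bigr => i _; rewrite rmorphXn rmorphD rmorph1 rmorphXn.
Qed.

Lemma rmorph_numerator : f (numerator q a) = numerator (f q) (f a).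
Proof.
rewrite /numerator rmorphB !rmorphM rmorph_neg_poch_sq rmorph_qint rmorph_int rmorphXn.
rewrite rmorph_sum rmorph_prod; congr (_ * _ - _ * _ * _ * _).
  apply: eq_bigr => k _; rewrite !rmorphM rmorph_qint rmorph_qbinomial !rmorph_prod.
  congr (_ * (_ * _) * _); apply: eq_bigr => l _; case: ifP => _.
  - exact: rmorph_num_step.
  - exact: rmorph_den_step.
  - exact: rmorph1.
  - by rewrite rmorphXn rmorphD rmorph1 rmorphXn.
by apply: eq_bigr => l _; rewrite rmorph_den_step.
Qed.

Lemma rmorph_denominator : f (denominator q a) = denominator (f q) (f a).
Proof.
rewrite /denominator !rmorphM rmorph_neg_poch_sq rmorphXn rmorph_prod; congr (_ * _).
by apply: eq_bigr => l _; rewrite rmorph_den_step.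
Qed.
End Morphism.

Section Evaluation.
Variables (F : fieldType) (q a : F).

Definition series_term (k : nat) : F :=
  step_prod q 1 a k * half_poch q (2 * k) * qint q (8 * k + 1).

Lemma qintE k : (1 - q) * qint q k = 1 - q ^+ k.
Proof. by rewrite /qint -opprB mulNr -subrX1 opprB. Qed.

Lemma qnumE k : 1 - q != 0 -> qnum q k = qint q k.
Proof. by move=> q1; apply: (mulfI q1); rewrite qintE /qnum mulrC divfK. Qed.

Lemma series_termE k :
  (1 - q) * series_term k = wz_summand q 1 (fun k => half_poch q (2 * k)) a k.
Proof.
rewrite /series_term mulrCA qintE /wz_summand mul1r; congr (_ * (1 - _)).
by rewrite -exprM -exprS; congr (_ ^+ _); lia.
Qed.

Hypothesis q0 : q != 0.
Hypothesis qN : forall i, 1 + q ^+ i.+1 != 0.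
Hypothesis dn : forall l, den_step q a l != 0.

Lemma num_stepE l : num_step q a l = step_ratio q a (q ^+ (2 * l)) * den_step q a l.
Proof.
have := dn l; rewrite /den_step mulf_eq0 negb_or => /andP[].
have -> : q ^+ (6 * l.+1) = q ^+ 6 * (q ^+ (2 * l)) ^+ 3.
  by rewrite -exprM -exprD; congr (_ ^+ _); lia.
rewrite /num_step /step_ratio; move: (q ^+ (2 * l)) => u n1 n2.
have {}n1 : 1 - a * q ^+ 6 * u ^+ 3 != 0 by rewrite -[a * _ * _]mulrA.
by field; rewrite n1 n2.
Qed.

Lemma denominator_neq0 : denominator q a != 0.
Proof.
rewrite /denominator !mulf_neq0 ?expf_neq0 ?neg_poch_sq_neq0 //.
by apply/prodf_neq0.
Qed.

Lemma numeratorE :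
  numerator q a =
  denominator q a * (\sum_(k < N) series_term k - q ^- n./2 * qint q n * (char3 n)%:~R).
Proof.
rewrite /numerator /denominator mulrBr; congr (_ - _); last first.
  have u0 : q ^+ n./2 != 0 by rewrite expf_neq0.
  by move: (q ^+ n./2) u0 => u u0; field.
rewrite -!mulrA; congr (_ * _); rewrite !mulr_sumr; apply: eq_bigr => k _.
have kN : (k <= N)%N by apply: ltnW.
rewrite /series_term.
have -> : \prod_(l < N) (if (l < k)%N then num_step q a l else den_step q a l) =
   step_prod q 1 a k * \prod_(l < N) den_step q a l.
  rewrite /step_prod (big_ord_widen N (fun l => step_ratio q a (1 * q ^+ (2 * l)))) //.
  rewrite [X in _ = X * _]big_mkcond -big_split; apply: eq_bigr => l _ /=.
  by case: ifP => _; rewrite ?mul1r // num_stepE.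
have -> : central_qbinomial q (2 * k) *
     \prod_(i < 2 * N) (if (i < 2 * k)%N then 1 else (1 + q ^+ i.+1) ^+ 2) =
     half_poch q (2 * k) * neg_poch_sq q (2 * N).
  rewrite /half_poch -mulrA; congr (_ * _).
  apply: (mulfI (neg_poch_sq_neq0 qN (2 * k))); rewrite mulVKf ?neg_poch_sq_neq0 //.
  rewrite /neg_poch_sq (big_ord_widen (2 * N) (fun i => (1 + q ^+ i.+1) ^+ 2)); last by rewrite leq_mul2l.
  rewrite big_mkcond -big_split; apply: eq_bigr => l _ /=.
  by case: ifP => _; rewrite ?mul1r ?mulr1.
ring.
Qed.

Lemma qpochS x y k : qpoch x y k.+1 = qpoch x y k * (1 - x * y ^+ k) :> F.
Proof. by rewrite /qpoch big_ord_recr. Qed.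

Lemma summandE k : a != 0 -> (forall i, 1 - q ^+ i.+1 != 0) ->
  summand a q k = series_term k.
Proof.
move=> a0 q1; rewrite /summand /series_term.
have q10 : 1 - q != 0 by have := q1 0; rewrite expr1.
rewrite qnumE //.
rewrite -half_pochE //; last by move=> i; rewrite mulnS add2n.
have -> : step_prod q 1 a k = qpoch (a * q) (q ^+ 2) k * qpoch (q / a) (q ^+ 2) k
   / (qpoch (a * q ^+ 6) (q ^+ 6) k * qpoch (q ^+ 6 / a) (q ^+ 6) k) * q ^+ (2 * k ^ 2).
  elim: k => [|k IH].
    by rewrite step_prod0 /qpoch !big_ord0 muln0 expr0 !mulr1 divr1.
  rewrite step_prodS {}IH !qpochS mul1r.
  have eg : q ^+ (2 * k.+1 ^ 2) = q ^+ (2 * k ^ 2) * (q ^+ 2 * (q ^+ (2 * k)) ^+ 2).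
    by rewrite -exprM -!exprD -!mulnn; congr (_ ^+ _); lia.
  have eu : (q ^+ 6) ^+ k = (q ^+ (2 * k)) ^+ 3 by rewrite -!exprM; congr (_ ^+ _); lia.
  have := dn k; rewrite /den_step mulf_eq0 negb_or => /andP[].
  have -> : q ^+ (6 * k.+1) = q ^+ 6 * (q ^+ (2 * k)) ^+ 3.
    by rewrite -exprM -exprD; congr (_ ^+ _); lia.
  rewrite {}eg {}eu -[(q ^+ 2) ^+ k]exprM; move: (q ^+ (2 * k)) (q ^+ (2 * k ^ 2)) => u g n1 n2.
  set P1 := qpoch (a * q) _ k; set P2 := qpoch (q / a) _ k.
  set P3 := qpoch (a * q ^+ 6) _ k; set P4 := qpoch (q ^+ 6 / a) _ k.
  have {}n1 : 1 - a * q ^+ 6 * u ^+ 3 != 0 by rewrite -[a * _ * _]mulrA.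
  have E (x1 x2 x3 x4 : F) : P1 * x1 * (P2 * x2) / (P3 * x3 * (P4 * x4)) =
      P1 * P2 / (P3 * P4) * (x1 * x2 / (x3 * x4)) by rewrite !invfM; ring.
  rewrite E -!(mulrA (P1 * P2 / (P3 * P4))); congr (_ * _).
  by rewrite /step_ratio; field; rewrite a0 n1 n2.
move: (qpoch _ _ k) (qpoch q _ _) (qpoch (q ^+ 2) _ _) (qpoch (a * q ^+ 6) _ _)
  (qpoch (q ^+ 6 / a) _ _) (qpoch (q / a) _ _) => *.
by rewrite !invfM; ring.
Qed.

End Evaluation.
End Numerator.

(** * Zeros of the numerator at a = q^n and a = q^(-n) *)

Section Interpolation.
Variables (F : fieldType) (q : F) (n : nat).
Hypotheses (q0 : q != 0) (q_inf : forall i, (0 < i)%N -> q ^+ i != 1).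
Hypothesis co : coprime n 6.

Lemma one_add_pow_neq0 i : 1 + q ^+ i.+1 != 0.
Proof.
apply/eqP => e; have /eqP[] := q_inf (i := i.+1 * 2) isT.
have -> : q ^+ (i.+1 * 2) = (1 + q ^+ i.+1) * (q ^+ i.+1 - 1) + 1 by rewrite exprM; ring.
by rewrite e mul0r add0r.
Qed.

Lemma den_step_invpow l : den_step q (q ^- n) l != 0.
Proof.
have [n1 n2] := regular_invpow q0 q_inf co l.
rewrite /den_step (_ : q ^+ (6 * l.+1) = q ^+ 6 * (1 * q ^+ (2 * l)) ^+ 3).
  by rewrite mulf_neq0 // mulrA.
by rewrite mul1r -exprM -exprD; congr (_ ^+ _); lia.
Qed.

Lemma den_stepV a l : a != 0 -> den_step q a^-1 l = a ^- 2 * den_step q a l.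
Proof. by move=> a0; rewrite /den_step; field. Qed.

Lemma den_step_pow l : den_step q (q ^+ n) l != 0.
Proof.
rewrite -[q ^+ n]invrK den_stepV ?invr_neq0 ?expf_neq0 //.
by rewrite mulf_neq0 ?den_step_invpow // invr_eq0 expf_eq0 /= invr_eq0 expf_neq0.
Qed.

Lemma step_ratioV a Y : a != 0 -> step_ratio q a^-1 Y = step_ratio q a Y.
Proof.
move=> a0; rewrite /step_ratio; congr (_ * _).
have E u w : (1 - a^-1 * u * w) * (a^-1 - u * w) = a ^- 2 * ((1 - a * u * w) * (a - u * w)).
  by field.
by rewrite !E invfM mulrACA mulfV ?mul1r // invr_neq0 // expf_neq0.
Qed.

Variable N : nat.
Hypothesis nN : (n < 2 * N)%N.

Lemma numerator_invpow : numerator n N q (q ^- n) = 0.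
Proof.
rewrite numeratorE //; [|exact: one_add_pow_neq0|exact: den_step_invpow].
have q1 : 1 - q != 0 by rewrite subr_eq0 eq_sym -[q]expr1 q_inf.
apply/eqP; rewrite mulf_eq0; apply/orP; right.
rewrite -(mulrI_eq0 _ (mulfI q1)) mulrBr mulr_sumr.
rewrite (eq_bigr _ (fun (k : 'I_N) _ => series_termE q (q ^- n) k)).
rewrite (sum_at_invpow q0 q_inf _ _ co nN) /target.
- by rewrite -qintE; apply/eqP; ring.
- by rewrite /half_poch /neg_poch_sq big_ord0 divr1.
- exact: one_step_rec_two_step (half_poch_rec one_add_pow_neq0).
Qed.

(** The summands are symmetric in a and 1/a, so this follows from the value at
    a = q^(-n). *)
Lemma numerator_pow : numerator n N q (q ^+ n) = 0.
Proof.
have := numerator_invpow; rewrite !numeratorE //; last first.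
- exact: den_step_invpow.
- exact: one_add_pow_neq0.
- exact: den_step_pow.
- exact: one_add_pow_neq0.
have -> : \sum_(k < N) series_term q (q ^- n) k = \sum_(k < N) series_term q (q ^+ n) k.
  apply: eq_bigr => k _; rewrite /series_term; congr (_ * _ * _).
  by apply: eq_bigr => l _; rewrite step_ratioV // expf_neq0.
move/eqP; rewrite mulf_eq0 => /orP[|/eqP->]; last by rewrite mulr0.
by rewrite (negPf (denominator_neq0 _ _ q0 one_add_pow_neq0 den_step_invpow)).
Qed.

End Interpolation.

(** * Zeros of the numerator at roots of unity, and linear factors *)

Lemma one_add_pow_neq0_unity (F : numDomainType) (n : nat) (z : F) i :
  odd n -> z ^+ n = 1 -> 1 + z ^+ i != 0.
Proof.
move=> odd_n zn; apply/eqP => /(canRL (addKr 1)); rewrite addr0 => /(congr1 (fun x => x ^+ n)).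
rewrite -exprM mulnC exprM zn expr1n -signr_odd odd_n expr1 => /eqP.
by rewrite -addr_eq0 -mulr2n pnatr_eq0.
Qed.

(** Both sums vanish by sum_blocks, and so does [n]. *)
Lemma numerator_unity (F : numFieldType) (n N : nat) (z x : F) :
  coprime n 6 -> N = n \/ N = n./2.+1 -> z ^+ n = 1 -> z != 1 ->
  x != 0 -> x ^+ n != 1 -> numerator n N z x = 0.
Proof.
move=> co NE zn z1 x0 xn.
have odd_n := coprime6_odd co.
have n0 : (0 < n)%N by case: n odd_n {co NE zn xn}.
have [d prim_z dn] := prim_order_exists n0 zn.
have co_d : coprime d 6 by apply: coprime_dvdl co.
have d1 : (1 < d)%N.
  have := prim_order_gt0 prim_z; rewrite leq_eqVlt => /orP[/eqP d1|//].
  by have := prim_expr_order prim_z; rewrite -d1 expr1 => e; rewrite e eqxx in z1.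
have xd : x ^+ d != 1.
  apply: contra xn => /eqP e; rewrite -(divnK dn) mulnC exprM e expr1n //.
have qN i : 1 + z ^+ i.+1 != 0 by apply: one_add_pow_neq0_unity zn.
have [reg _] := generic_outside prim_z 0 x0 xd.
have dnx l : den_step z x l != 0.
  have [n1 n2] := reg l.
  rewrite /den_step (_ : z ^+ (6 * l.+1) = z ^+ 6 * (z ^+ 0 * z ^+ (2 * l)) ^+ 3).
    by rewrite mulf_neq0 // mulrA.
  by rewrite expr0 mul1r -exprM -exprD; congr (_ ^+ _); lia.
have nz1 : 1 - z != 0 by rewrite subr_eq0 eq_sym.
have z0 := q_neq0 d1 prim_z.
rewrite numeratorE //; apply/eqP; rewrite mulf_eq0; apply/orP; right.
rewrite -(mulrI_eq0 _ (mulfI nz1)) mulrBr mulr_sumr.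
rewrite (eq_bigr _ (fun (k : 'I_N) _ => series_termE z x k)).
rewrite -(mulrA (z ^- _)) mulrCA (mulrA (1 - z)) qintE zn subrr mul0r mulr0 subr0.
have [L nE] := dvdnP dn.
have odd_d := coprime6_odd co_d.
have [s1 s2] := sum_blocks d1 co_d prim_z (half_poch_rec qN) x0 xd L.
have [_ s3] := sum_blocks d1 co_d prim_z (half_poch_rec qN) x0 xd L./2.
case: NE => ->; first by move: s1; rewrite -nE => ->.
have odd_L : odd L by move: odd_n; rewrite nE oddM => /andP[].
have -> : (n./2.+1 = L./2 * d + (d./2).+1)%N by nia.
by rewrite s3.
Qed.

Section Factor.
Variable R : idomainType.
Local Notation tof := (@FracField.tofrac R).

(** Modulo 1 - cX one has cX = 1, so c^N p is congruent to c^N p(1/c) = 0 for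
    N = size p; and p itself is congruent to X^N c^N p. *)
Lemma inv_root_factor (p : {poly R}) c : c != 0 ->
  (map_poly tof p).[(tof c)^-1] = 0 -> exists r, p = r * (1 - 'X * c%:P).
Proof.
move=> c0 pc; pose N := size p.
have tc : tof c != 0 by rewrite tofrac_eq0.
have s0 : \sum_(i < N) p`_i * c ^+ (N - i) = 0.
  apply/eqP; rewrite -(tofrac_eq0 (R := R)) rmorph_sum /=; apply/eqP.
  transitivity (tof c ^+ N * (map_poly tof p).[(tof c)^-1]); last by rewrite pc mulr0.
  rewrite horner_poly mulr_sumr; apply: eq_bigr => i _.
  rewrite rmorphM rmorphXn /= [RHS]mulrCA; congr (_ * _).
  by rewrite exprVn expfB_cond // (negPf tc) add0n ltnW.
pose y := 'X * c%:P : {poly R}.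
pose g i := \sum_(j < i) y ^+ j.
have gE i : y ^+ i = 1 - (1 - y) * g i by rewrite /g -(opprB y) mulNr -subrX1; ring.
have cp : (c ^+ N)%:P * p = - (\sum_(i < N) (p`_i * c ^+ (N - i))%:P * g i) * (1 - y).
  rewrite -{1}[p]coefK poly_def mulr_sumr.
  transitivity (\sum_(i < N) (p`_i * c ^+ (N - i))%:P * y ^+ i).
    apply: eq_bigr => i _; rewrite -mul_polyC /y exprMn -polyC_exp.
    have -> : c ^+ N = c ^+ (N - i) * c ^+ i by rewrite -exprD subnK // ltnW.
    by rewrite !polyCM; ring.
  transitivity ((\sum_(i < N) (p`_i * c ^+ (N - i))%:P) +
     - (\sum_(i < N) (p`_i * c ^+ (N - i))%:P * g i) * (1 - y)).
    rewrite mulNr mulr_suml -sumrB; apply: eq_bigr => i _; rewrite gE; ring.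
  by rewrite -rmorph_sum s0 add0r.
exists (p * g N - 'X^N * (\sum_(i < N) (p`_i * c ^+ (N - i))%:P * g i)).
rewrite -/y mulrBl -mulrA (mulrC (g N)) -[_ * _ * (1 - y)]mulrA.
have -> : 'X^N * ((\sum_(i < N) (p`_i * c ^+ (N - i))%:P * g i) * (1 - y)) =
   - ('X^N * ((c ^+ N)%:P * p)) by rewrite cp; ring.
have -> : 'X^N * ((c ^+ N)%:P * p) = p * y ^+ N by rewrite exprMn polyC_exp; ring.
by rewrite gE; ring.
Qed.

Lemma root_pair_factor (p : {poly R}) c : c != 0 -> c ^+ 2 != 1 ->
  p.[c] = 0 -> (map_poly tof p).[(tof c)^-1] = 0 ->
  exists r, p = r * (1 - 'X * c%:P) * ('X - c%:P).
Proof.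
move=> c0 c2 pc pc'; have /factor_theorem[s sE] : root p c by apply/eqP.
have [|r rE] := @inv_root_factor s c c0; last by exists r; rewrite sE rE.
have tc : tof c != 0 by rewrite tofrac_eq0.
move/eqP: pc'; rewrite sE rmorphM hornerM mulf_eq0 => /orP[/eqP //|].
rewrite rmorphB /= map_polyX map_polyC hornerD hornerN hornerX hornerC.
rewrite subr_eq0 -(inj_eq (mulfI tc)) mulfV // -expr2 -tofracXn -tofrac1 tofrac_eq.
by rewrite eq_sym (negPf c2).
Qed.
End Factor.

(** * Divisibility of integer polynomials by [n] *)

Lemma size_qintX (R : idomainType) n : size (qint ('X : {poly R}) n) = n.
Proof.
case: n => [|n]; first by rewrite /qint big_ord0 size_poly0.
have /(congr1 (fun p : {poly R} => size p)) := subrX1 ('X : {poly R}) n.+1.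
rewrite -polyC1 size_XnsubC // -/(qint _ _) => e.
have g0 : qint ('X : {poly R}) n.+1 != 0.
  by apply: contraPneq e => ->; rewrite mulr0 size_poly0.
by move: e; rewrite size_monicM ?monicXsubC // size_XsubC => -[].
Qed.

Lemma qintX_monic (R : idomainType) n : (0 < n)%N -> qint ('X : {poly R}) n \is monic.
Proof.
move=> n0; rewrite -(monicMl _ (monicXsubC (1 : R))) polyC1 /qint -subrX1 -polyC1.
exact: monicXnsubC.
Qed.

(** The remainder of p modulo the monic polynomial [n] has degree less than
    n - 1 and vanishes at the n - 1 nontrivial n-th roots of unity. *)
Lemma qint_dvd n (p : {poly int}) : (0 < n)%N ->
  (forall z : algC, z ^+ n = 1 -> z != 1 -> (map_poly intr p).[z] = 0) ->
  exists r, p = r * qint 'X n.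
Proof.
move=> n0 H; have mon := @qintX_monic int n n0.
have eq := Pdiv.RingMonic.rdivp_eq mon p.
have sz : (size (Pdiv.Ring.rmodp p (qint 'X n)) < n)%N.
  by rewrite -{2}(size_qintX int n) Pdiv.Ring.ltn_rmodpN0 // monic_neq0.
suff r0 : Pdiv.Ring.rmodp p (qint 'X n) = 0.
  by exists (Pdiv.Ring.rdivp p (qint 'X n)); rewrite {1}eq r0 addr0.
set r := Pdiv.Ring.rmodp _ _ in eq sz *.
have Hr (z : algC) : z ^+ n = 1 -> z != 1 -> (map_poly intr r).[z] = 0.
  move=> zn z1; have := H z zn z1.
  rewrite eq rmorphD rmorphM /= hornerD hornerM rmorph_qint /= map_polyX.
  have -> : (qint 'X n).[z] = qint z n.
    by rewrite -[LHS]/(horner_eval z _) rmorph_qint /= /horner_eval hornerX.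
  suff -> : qint z n = 0 by rewrite mulr0 add0r.
  apply: (mulfI (x := 1 - z)); first by rewrite subr_eq0 eq_sym.
  by rewrite qintE zn subrr mulr0.
have [w prim_w] := C_prim_root_exists n0.
pose rs := [seq w ^+ i | i <- iota 1 n.-1].
have szr : size (map_poly intr r : {poly algC}) = size r.
  by rewrite size_map_inj_poly //; apply: intr_inj.
apply/eqP/negPn/negP => r0.
have p0 : map_poly intr r != 0 :> {poly algC} by rewrite -size_poly_eq0 szr size_poly_eq0.
have := max_poly_roots (rs := rs) p0.
suff [-> ->] : all (root (map_poly intr r)) rs /\ uniq rs.
  rewrite size_map size_iota szr => /(_ isT isT).
  by rewrite prednK // leqNgt sz.
split.
  apply/allP => x /mapP[i]; rewrite mem_iota => i_n ->; rewrite rootE Hr //.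
    by rewrite -exprM mulnC exprM (prim_expr_order prim_w) expr1n.
  by rewrite -(prim_order_dvd prim_w) gtnNdvd //; lia.
rewrite map_inj_in_uniq ?iota_uniq // => i j; rewrite !mem_iota => i_n j_n.
by move/eqP; rewrite (eq_prim_root_expr prim_w) !modn_small; [move/eqP| lia | lia].
Qed.

(** * Divisibility and coprimality in Z[q][a] *)

Definition evalq (z : algC) : {rmorphism {poly int} -> algC} :=
  horner_eval z \o map_poly intr.

Arguments evalq : simpl never.

Lemma evalqX z : evalq z 'X = z.
Proof. by rewrite -[LHS]/((map_poly intr 'X).[z]) map_polyX hornerX. Qed.

Definition evalqa (z x : algC) : {rmorphism Zaq -> algC} :=
  horner_eval x \o map_poly (evalq z).

Lemma evalqa_q z x : evalqa z x poly_q = z.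
Proof. rewrite -[LHS]/((map_poly (evalq z) 'X%:P).[x]) map_polyC hornerC; exact: evalqX. Qed.

Lemma evalqa_a z x : evalqa z x poly_a = x.
Proof. by rewrite -[LHS]/((map_poly (evalq z) 'X).[x]) map_polyX hornerX. Qed.

Lemma qnum_polyE n : qnum_poly n = (qint 'X n)%:P.
Proof.
by rewrite /qnum_poly /qint rmorph_sum; apply: eq_bigr => i _; rewrite /poly_q -polyC_exp.
Qed.

Lemma modulusE n : (modulus n : {poly {poly int}}) =
  (qint ('X : {poly int}) n)%:P * (1 - 'X * ('X^n)%:P) * ('X - ('X^n)%:P).
Proof. by rewrite /modulus qnum_polyE /poly_a /poly_q -polyC_exp. Qed.

Lemma coprimep_root_pair (F : fieldType) (A : {poly F}) (g c : F) :
  g != 0 -> c != 0 -> A.[c] != 0 -> A.[c^-1] != 0 ->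
  coprimep A (g%:P * (1 - 'X * c%:P) * ('X - c%:P)).
Proof.
move=> g0 c0 Ac Ac'.
have -> : g%:P * (1 - 'X * c%:P) * ('X - c%:P) =
   (g * - c) *: (('X - (c^-1)%:P) * ('X - c%:P)).
  have cc : c%:P * (c^-1)%:P = 1 :> {poly F} by rewrite -polyCM mulfV.
  rewrite -mul_polyC polyCM polyCN.
  transitivity (g%:P * (c%:P * (c^-1)%:P - 'X * c%:P) * ('X - c%:P)); first by rewrite cc.
  by ring.
rewrite coprimepZr ?mulf_neq0 ?oppr_eq0 // coprimepMr !coprimep_XsubC !rootE.
by rewrite Ac Ac'.
Qed.

Section Divides.
Variables (n N : nat).
Hypotheses (co : coprime n 6) (NE : N = n \/ N = n./2.+1).

Let odd_n : odd n.
Proof. exact: coprime6_odd. Qed.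
Let n_gt0 : (0 < n)%N. Proof. exact: odd_gt0. Qed.
Let nN : (n < 2 * N)%N. Proof. by case: NE => ->; lia. Qed.

Local Notation tof := (@FracField.tofrac {poly int}).

Lemma tofX_neq0 : tof 'X != 0. Proof. by rewrite tofrac_eq0 polyX_eq0. Qed.

Lemma tofX_pow_neq1 i : (0 < i)%N -> tof 'X ^+ i != 1.
Proof.
move=> i0; rewrite -tofracXn -tofrac1 tofrac_eq; apply/eqP.
move/(congr1 (fun p : {poly int} => size p)); rewrite size_polyXn size_poly1.
by case: i i0.
Qed.

Lemma Xn2_neq1 : ('X^n : {poly int}) ^+ 2 != 1.
Proof. by rewrite -exprM -(tofrac_eq) tofracXn tofrac1 tofX_pow_neq1 //; rewrite muln_gt0 n_gt0. Qed.

(** numerator_pow and numerator_invpow, read in the field Q(q). *)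
Lemma numerator_factor : exists r, numerator n N poly_q poly_a =
  r * (1 - 'X * ('X^n)%:P) * ('X - ('X^n)%:P).
Proof.
have Xn0 : 'X^n != 0 :> {poly int} by rewrite monic_neq0 ?monicXn.
apply: (root_pair_factor Xn0 Xn2_neq1).
  have e := rmorph_numerator n N (horner_eval ('X^n : {poly int})) poly_q poly_a.
  rewrite /= /horner_eval hornerX hornerC in e.
  apply: (etrans e).
  apply/eqP; rewrite -(tofrac_eq0 (R := {poly int})) rmorph_numerator rmorphXn; apply/eqP.
  exact: (numerator_pow tofX_neq0 tofX_pow_neq1 co nN).
have e := rmorph_numerator n N (horner_eval ((tof 'X^n)^-1) \o map_poly tof) poly_q poly_a.
rewrite /= /horner_eval /poly_q /poly_a map_polyX hornerX map_polyC hornerC /= tofracXn in e.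
rewrite tofracXn; apply: (etrans e).
exact: (numerator_invpow tofX_neq0 tofX_pow_neq1 co nN).
Qed.

(** The cofactor r of numerator_factor vanishes at each nontrivial n-th root of
    unity z, because there (1 - a z^n)(a - z^n) = -(a - 1)^2 is nonzero; hence
    [n] divides every coefficient of r. *)
Lemma modulus_divides_numerator : divides (modulus n) (numerator n N poly_q poly_a).
Proof.
have [r rE] := numerator_factor.
have r0 (z : algC) : z ^+ n = 1 -> z != 1 -> map_poly (evalq z) r = 0.
  move=> zn z1; have : map_poly (evalq z) (numerator n N poly_q poly_a) = 0.
    apply: (poly_generic_eq0 n_gt0) => x x0 xn.
    rewrite -[LHS]/(evalqa z x _) rmorph_numerator evalqa_q evalqa_a.
    exact: numerator_unity.
  rewrite rE !rmorphM !rmorphB rmorphM rmorph1 /= map_polyX !map_polyC /=.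
  rewrite map_polyXn /horner_eval hornerXn zn mulr1.
  move/eqP; rewrite mulf_eq0 polyXsubC_eq0 orbF mulf_eq0 => /orP[/eqP//|].
  by rewrite -opprB oppr_eq0 polyXsubC_eq0.
have rc i : exists s, r`_i = s * qint 'X n.
  apply: qint_dvd => // z zn z1.
  by rewrite -[LHS]/(evalq z _) -coef_map r0 // coef0.
pose s := \poly_(i < size r) (r`_i %/ qint 'X n).
exists s; rewrite modulusE rE !mulrA; congr (_ * _ * _).
apply/polyP => i; rewrite coefMC coef_poly; case: ltnP => [_|ge]; last first.
  by rewrite nth_default // mul0r.
have [c ->] := rc i.
by rewrite Pdiv.IdomainMonic.mulpK // qintX_monic.
Qed.

Let qN : forall i, 1 + tof 'X ^+ i.+1 != 0 := one_add_pow_neq0 tofX_pow_neq1.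

(** Over Q(q) the modulus is a constant times two linear polynomials in a,
    and the denominator is nonzero at their roots q^(-n) and q^n. *)
Lemma common_divisor_const d : divides d (modulus n) ->
  divides d (denominator n N poly_q poly_a) -> size (d : {poly {poly int}}) = 1%N.
Proof.
move=> [u uE] [w wE]; pose c : {fraction {poly int}} := tof 'X ^+ n.
have c0 : c != 0 by rewrite expf_neq0 ?tofX_neq0.
have tof_inj : injective tof by move=> x y /eqP; rewrite tofrac_eq => /eqP.
have den_neq0 (x : {fraction {poly int}}) : (forall l, den_step (tof 'X) x l != 0) ->
    (map_poly tof (denominator n N poly_q poly_a)).[x] != 0.
  move=> dn; have := rmorph_denominator n N (horner_eval x \o map_poly tof) poly_q poly_a.
  rewrite /= /horner_eval /poly_q /poly_a map_polyX hornerX map_polyC hornerC /= => ->.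
  exact: (denominator_neq0 _ _ tofX_neq0 qN dn).
have A1 : (map_poly tof (denominator n N poly_q poly_a)).[c] != 0.
  by apply: den_neq0 => l; apply: (den_step_pow tofX_neq0 tofX_pow_neq1 co).
have A2 : (map_poly tof (denominator n N poly_q poly_a)).[c^-1] != 0.
  by apply: den_neq0 => l; apply: (den_step_invpow tofX_neq0 tofX_pow_neq1 co).
have g0 : tof (qint 'X n) != 0 by rewrite tofrac_eq0 monic_neq0 ?qintX_monic.
have cop := coprimep_root_pair g0 c0 A1 A2.
have PE : map_poly tof (modulus n) =
    (tof (qint 'X n))%:P * (1 - 'X * c%:P) * ('X - c%:P).
  by rewrite modulusE !rmorphM !rmorphB rmorphM rmorph1 /= map_polyX !map_polyC /= tofracXn.
rewrite -PE in cop.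
have /eqp_size : map_poly tof d %= 1.
  have /coprimepP := cop; apply.
    by rewrite wE rmorphM dvdp_mull.
  by rewrite uE rmorphM dvdp_mull.
by rewrite size_poly1 size_map_inj_poly ?tofrac0.
Qed.
End Divides.

Lemma pow2_neq1 i : (2 : algC) ^+ i.+1 != 1.
Proof. by rewrite -natrX pnatr_eq1 expnS; lia. Qed.

Lemma rmorph_modulus (S : comNzRingType) (f : {rmorphism Zaq -> S}) n :
  f (modulus n) = qint (f poly_q) n * (1 - f poly_a * f poly_q ^+ n) * (f poly_a - f poly_q ^+ n).
Proof.
rewrite /modulus (rmorphM f) (rmorphM f) (rmorphB f) (rmorphB f) (rmorphM f) (rmorph1 f) (rmorphXn f).
congr (_ * _ * _).
exact: (rmorph_qint f poly_q n).
Qed.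

Section Coprime.
Variables (n N : nat).
Hypothesis co : coprime n 6.

Let odd_n : odd n.
Proof. exact: coprime6_odd. Qed.
Let n_gt0 : (0 < n)%N. Proof. exact: odd_gt0. Qed.

Lemma den_step_unity_neq0 (z x : algC) l : z ^+ n = 1 -> x ^+ n != 1 -> den_step z x l != 0.
Proof.
move=> zn xn; rewrite /den_step; set i := (6 * l.+1)%N.
have zin : (z ^+ i) ^+ n = 1 by rewrite -exprM mulnC exprM zn expr1n.
rewrite mulf_neq0 //; apply: contra xn; rewrite subr_eq0 => /eqP e.
  by rewrite -[x ^+ n]mulr1 -{1}zin -exprMn -e expr1n.
by rewrite e zin.
Qed.

(** A common divisor lies in Z[q].  A complex root z of it is a root of the
    modulus at a = 1, so z^n = 1, and at such a z the denominator is not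
    identically zero in a, because n is odd.  Thus the divisor is an integer, and it divides the value 1 of
    the modulus at q = 0, a = 1. *)
Lemma coprime_modulus_denominator :
  coprime_elts (modulus n) (denominator n N poly_q poly_a).
Proof.
move=> d dm dd; have /eqP size_d := common_divisor_const co dm dd.
have [u uE] := dm; have [w wE] := dd.
have /size_poly1P[e e0 dE] := size_d.
have size_e : size e == 1%N.
  rewrite -(size_map_inj_poly (f := intr : int -> algC)) //; last exact: intr_inj.
  apply/negPn/negP => /closed_rootP[z /eqP ez].
  have dz x : evalqa z x d = 0.
    rewrite dE -[LHS]/((map_poly (evalq z) e%:P).[x]) map_polyC hornerC; exact: ez.
  have zn : z ^+ n = 1.
    have := rmorph_modulus (evalqa z 1) n; rewrite uE rmorphM dz mulr0.
    rewrite evalqa_q evalqa_a mul1r => /esym/eqP; rewrite !mulf_eq0 -orbA orbb.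
    rewrite subr_eq0 => /orP[/eqP g0|/eqP<-//].
    by apply/eqP; rewrite eq_sym -subr_eq0 -qintE g0 mulr0.
  have z0 : z != 0.
    by apply/eqP => z0; move/eqP: zn; rewrite z0 expr0n eqn0Ngt n_gt0 /= eq_sym oner_eq0.
  (* a = 2 serves as a value whose n-th power differs from 1. *)
  have /eqP[] : denominator n N z 2 != 0; last first.
    by rewrite -[z](evalqa_q z 2) -{2}[2](evalqa_a z 2) -rmorph_denominator wE rmorphM dz mulr0.
  apply: denominator_neq0 => // [i|l]; first exact: one_add_pow_neq0_unity zn.
  by apply: den_step_unity_neq0; rewrite // -(prednK n_gt0) pow2_neq1.
rewrite poly_unitE size_d dE coefC eqxx poly_unitE size_e /=.
have /size_poly1P[k k0 eE] := size_e.
pose f : {rmorphism Zaq -> int} := horner_eval (0 : int) \o horner_eval (1 : {poly int}).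
have fq : f poly_q = 0 by rewrite /f /= /horner_eval hornerC hornerX.
have fa : f poly_a = 1 by rewrite /f /= /horner_eval hornerX hornerC.
have fd : f d = k by rewrite dE eE /f /= /horner_eval !hornerC.
have := rmorph_modulus f n; rewrite fq fa uE rmorphM fd.
have g1 : qint (0 : int) n = 1.
  by rewrite /qint -(prednK n_gt0) big_ord_recl big1 ?addr0 // => i _; rewrite exprS mul0r.
rewrite g1 expr0n eqn0Ngt n_gt0 /= !(mulr0, subr0, mulr1) => e1.
by rewrite eE coefC eqxx; apply/unitrPr; exists (f u); rewrite mulrC.
Qed.
End Coprime.

(** * The congruence modulo [n](1 - a q^n)(a - q^n) *)
Section Congruence.
Variables (n N : nat).
Hypotheses (co : coprime n 6) (NE : N = n \/ N = n./2.+1).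

Let odd_n : odd n.
Proof. exact: coprime6_odd. Qed.

(** Elements of Z[q][a] are seen to be nonzero by evaluation; below, the point
    q = 2, a = 3 is a zero of none of the factors in question. *)
Lemma tofrac_neq0 (p : Zaq) (z x : algC) :
  evalqa z x p != 0 -> FracField.tofrac p != 0.
Proof. by rewrite tofrac_eq0; apply: contraNneq => ->; rewrite rmorph0. Qed.

(** The two sums of the theorem differ only in the number N of summands. *)
Lemma sum_summand_cong :
  frac_cong (\sum_(0 <= k < N) summand frac_a frac_q k)
            (frac_q ^- ((n - 1) %/ 2) * qnum frac_q n * (char3 n)%:~R)
            (modulus n).
Proof.
have q0 : frac_q != 0.
  by apply: (@tofrac_neq0 _ 2 3); rewrite evalqa_q pnatr_eq0.
have a0 : frac_a != 0.
  by apply: (@tofrac_neq0 _ 2 3); rewrite evalqa_a pnatr_eq0.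
have qN i : 1 + frac_q ^+ i.+1 != 0.
  rewrite /frac_q -tofrac1 -tofracXn -tofracD; apply: (@tofrac_neq0 _ 2 3).
  by rewrite rmorphD rmorph1 rmorphXn evalqa_q -natrX -mulrS pnatr_eq0.
have q1 i : 1 - frac_q ^+ i.+1 != 0.
  rewrite /frac_q -tofrac1 -tofracXn -tofracB; apply: (@tofrac_neq0 _ 2 3).
  by rewrite rmorphB rmorph1 rmorphXn evalqa_q subr_eq0 eq_sym pow2_neq1.
have dn l : den_step frac_q frac_a l != 0.
  rewrite -(rmorph_den_step (@FracField.tofrac Zaq)); apply: (@tofrac_neq0 _ 2 3).
  rewrite rmorph_den_step evalqa_q evalqa_a /den_step mulf_neq0 //.
    rewrite subr_eq0 eq_sym -natrX -natrM pnatr_eq1 mulnS expnD; lia.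
  by rewrite subr_eq0 -natrX eqr_nat mulnS expnD; lia.
exists (numerator n N poly_q poly_a), (denominator n N poly_q poly_a); split.
- rewrite -(tofrac_eq0 (R := Zaq)) (rmorph_denominator n N (@FracField.tofrac Zaq)).
  exact: (denominator_neq0 _ _ q0 qN dn).
- rewrite [X in _ = X / _](rmorph_numerator n N (@FracField.tofrac Zaq)).
  rewrite [X in _ = _ / X](rmorph_denominator n N (@FracField.tofrac Zaq)).
  rewrite (numeratorE n N q0 qN dn).
  rewrite -/frac_q -/frac_a [RHS]mulrAC mulfV; last exact: (denominator_neq0 _ _ q0 qN dn).
  rewrite mul1r big_mkord; congr (_ - _ * _ * _).
  + by apply: eq_bigr => k _; exact: (summandE q0 qN dn k a0 q1).
  + by congr (_ ^- _); lia.
  + by apply: qnumE; have := q1 0; rewrite expr1.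
- exact: modulus_divides_numerator.
- exact: coprime_modulus_denominator.
Qed.
End Congruence.

Theorem theorem1p4 (n : nat) (n_gt0 : (0 < n)%N) (n_co6 : coprime n 6) :
  frac_cong (\sum_(0 <= k < n) summand frac_a frac_q k)
            (frac_q ^- ((n - 1) %/ 2) * qnum frac_q n * (char3 n)%:~R)
            (modulus n)
  /\
  frac_cong (\sum_(0 <= k < ((n - 1) %/ 2).+1) summand frac_a frac_q k)
            (frac_q ^- ((n - 1) %/ 2) * qnum frac_q n * (char3 n)%:~R)
            (modulus n).
Proof.
have odd_n := coprime6_odd n_co6.
split; apply: sum_summand_cong => //; first by left.
by right; lia.
Qed.
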